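(* Let $m\ge3$ be an integer, $\mathscr{A}=\{A_1,\dots,A_{m-1}\}$, and $$\rho_m=\lVert A_{\lfloor m/2\rfloor}\rVert_2,\qquad \alpha_m=\frac{\log(m-1)}{2\log(\rho_m)}.$$ Then the following statements are true. (1) The joint spectral radius of $\mathscr{A}$ is $\tilde\rho(\mathscr{A})=\rho_m$. (2) The Minkowski function $M_m:[0,\lambda^{-1}]\to[0,1]$ is Hölder of exponent $\alpha_m$, and is not Hölder of exponent $\beta$, for any $\beta>\alpha_m$.
   Context: Fix an integer $m\ge3$ and let $\lambda=2\cos(\pi/m)$. Matrices in $\mathrm{PSL}_2\mathbb{R}$ are taken up to sign (norms and the joint spectral radius do not depend on the choice of sign) and act on $\mathbb{R}\cup\{\infty\}$ by $x\mapsto(ax+b)/(cx+d)$. Let $$L=\begin{pmatrix}1&0\\ \lambda&1\end{pmatrix},\ S=\begin{pmatrix}0&-1\\1&0\end{pmatrix},\ R=L^{-1}S=\begin{pmatrix}0&-1\\1&\lambda\end{pmatrix},$$ and, for $j=1,\dots,m-1$, $A_j=SR^{-j}$, $B_j=LA_jL^{-1}$ (each $B_j$ maps $[0,\lambda^{-1}]$ into itself), and $C_j(x)=\frac{x+j-1}{m-1}$. $\lVert D\rVert_2$ is the spectral norm (the square root of the spectral radius of $D^TD$). For a finite set $\mathscr{D}$ of real square matrices of the same dimension, the joint spectral radius is $$\tilde\rho(\mathscr{D})=\limsup_{n\to\infty}\max\{\lVert D\rVert^{1/n}:D\text{ is a product of }n\text{ elements of }\mathscr{D}\},$$ for any operator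 norm $\lVert\cdot\rVert$ induced by a vector norm (the choice is irrelevant). Minkowski function: define $\pi_{\mathscr{B}}:\{1,\dots,m-1\}^{\mathbb{Z}_{\ge0}}\to[0,\lambda^{-1}]$ and $\pi_{\mathscr{C}}:\{1,\dots,m-1\}^{\mathbb{Z}_{\ge0}}\to[0,1]$ by $$\{\pi_{\mathscr{B}}(\omega)\}=\bigcap_{n\ge0}B_{\omega(0)}\cdots B_{\omega(n-1)}[0,\lambda^{-1}],\qquad \{\pi_{\mathscr{C}}(\omega)\}=\bigcap_{n\ge0}C_{\omega(0)}\cdots C_{\omega(n-1)}[0,1]$$ (the intersections are singletons). These maps are continuous, surjective, and have the same fibers, so $M_m=\pi_{\mathscr{C}}\circ\pi_{\mathscr{B}}^{-1}$ is a well-defined order-preserving homeomorphism from $[0,\lambda^{-1}]$ to $[0,1]$. A function $g$ on $[0,\lambda^{-1}]$ is Hölder of exponent $\alpha$ if there is a constant $c$ with $|g(x')-g(x)|\le c\,|x'-x|^\alpha$ for all $x,x'$. *)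

(* Defs.v *)
From mathcomp Require Import all_boot all_order all_algebra.
From mathcomp Require Import all_classical all_reals all_analysis.
From mathcomp Require Import complex.
Set Implicit Arguments.
Unset Strict Implicit.
Unset Printing Implicit Defensive.
Import Order.TTheory GRing.Theory Num.Theory.
Local Open Scope classical_set_scope.
Local Open Scope ring_scope.

Section Norms.
Variables (R : realType) (d : nat).

(* Largest modulus of a complex eigenvalue. *)
Definition spectral_radius (M : 'M[R]_d) : R :=
  sup [set ComplexField.Normc.normc z
      | z in [set z : R[i] | eigenvalue (map_mx (real_complex R) M) z]].

Definition spectral_norm (M : 'M[R]_d) : R :=
  Num.sqrt (spectral_radius (M^T *m M)).

Definition is_vector_norm (N : 'cV[R]_d -> R) : Prop :=
  [/\ forall x y, N (x + y) <= N x + N y,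
      forall (a : R) x, N (a *: x) = `|a| * N x
    & forall x, N x = 0 -> x = 0].

Definition operator_norm (N : 'cV[R]_d -> R) (M : 'M[R]_d) : R :=
  sup [set N (M *m x) | x in [set x | N x <= 1]].

Definition products (D : set 'M[R]_d) (n : nat) : set 'M[R]_d :=
  [set \prod_(X <- w) X
  | w in [set w : seq 'M[R]_d | size w = n /\ forall X, X \in w -> D X]].

(* For finite nonempty D the inner supremum is over a finite nonempty set,
   hence a maximum.  The term n = 0, where n^-1 = 0, does not affect the
   limit superior. *)
Definition joint_spectral_radius
    (N : 'cV[R]_d -> R) (D : set 'M[R]_d) : \bar R :=
  limn_esup (fun n : nat =>
    ereal_sup [set (operator_norm N M `^ (n%:R)^-1)%:E | M in products D n]).

End Norms.

Section Matrices.
Variables (R : realType) (m : nat).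

Definition mx2 (a b c d : R) : 'M[R]_2 :=
  \matrix_(i, j) if i == 0 then (if j == 0 then a else b)
                 else (if j == 0 then c else d).

Definition lambda : R := 2 * cos (pi / m%:R).

(* Elements of PSL_2(R) are represented by matrices of determinant 1; neither
   norms nor the Moebius action see the sign. *)
Definition matL : 'M[R]_2 := mx2 1 0 lambda 1.
Definition matS : 'M[R]_2 := mx2 0 (-1) 1 0.
Definition matR : 'M[R]_2 := matL^-1 * matS.
Definition matA (j : nat) : 'M[R]_2 := matS * matR ^- j.
Definition matB (j : nat) : 'M[R]_2 := matL * matA j * matL^-1.

Definition familyA : set 'M[R]_2 := [set matA j | j in [set j | (0 < j < m)%N]].

(* The action on R; it is only applied to the B_j on [0, lambda^-1], where
   c * x + d does not vanish because B_j maps this interval into itself. *)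
Definition moebius (M : 'M[R]_2) (x : R) : R :=
  (M 0 0 * x + M 0 1) / (M 1 0 * x + M 1 1).

Definition mapB (j : nat) : R -> R := moebius (matB j).
Definition mapC (j : nat) (x : R) : R := (x + j%:R - 1) / (m%:R - 1).

Definition rho : R := spectral_norm (matA m./2).
Definition alpha : R := ln (m%:R - 1) / (2 * ln rho).

End Matrices.

Arguments matL R m : clear implicits.
Arguments matS R : clear implicits.
Arguments matR R m : clear implicits.
Arguments matA R m j : clear implicits.
Arguments matB R m j : clear implicits.
Arguments familyA R m _ : clear implicits.
Arguments mapB R m j x : clear implicits.
Arguments mapC R m j x : clear implicits.

Section Minkowski.
Variable R : realType.

(* F (w 0) (F (w 1) (... (F (w n.-1) I))) *)
Definition cylinder (F : nat -> R -> R) (I : set R) (w : nat -> nat)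
    (n : nat) : set R :=
  (\big[comp/idfun]_(0 <= i < n) F (w i)) @` I.

Definition coding (F : nat -> R -> R) (I : set R) (w : nat -> nat) : R :=
  xget 0 [set x | \bigcap_(n : nat) cylinder F I w n = [set x]].

Definition digit_sequence (m : nat) : set (nat -> nat) :=
  [set w | forall i, (0 < w i < m)%N].

Definition piB (m : nat) : (nat -> nat) -> R :=
  coding (mapB R m) `[0, (lambda R m)^-1].

Definition piC (m : nat) : (nat -> nat) -> R :=
  coding (mapC R m) `[0, 1].

(* The element of pi_C (pi_B^-1 {x}), a singleton for x in [0, lambda^-1];
   the values outside this interval are irrelevant. *)
Definition minkowski_fun (m : nat) (x : R) : R :=
  xget 0 (piC m @` (digit_sequence m `&` piB m @^-1` [set x])).

Definition holder_on (I : set R) (g : R -> R) (a : R) : Prop :=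
  exists c : R, forall x x', I x -> I x' ->
    `|g x' - g x| <= c * `|x' - x| `^ a.

End Minkowski.

Arguments minkowski_fun R m x : clear implicits.

(* Main.v *)
Require Import Defs.
From mathcomp Require Import all_boot all_order all_algebra.
From mathcomp Require Import all_classical all_reals all_analysis.
From mathcomp Require Import complex ring lra zify.
Set Implicit Arguments.
Unset Strict Implicit.
Unset Printing Implicit Defensive.
Import Order.TTheory GRing.Theory Num.Theory.
Import numFieldNormedType.Exports.
Local Open Scope classical_set_scope.
Local Open Scope ring_scope.

(** With theta = pi/m and s_j = sin(j theta)/sin(theta), the matrix A_j is
    [[s_j, s_(j-1)], [s_(j+1), s_j]]: it is nonnegative, has determinant 1 and
    squared Frobenius norm 2 + (lambda s_j)^2.  Since the determinant is 1, this
    norm determines the spectral norm, which is therefore largest for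
    j = h := floor(m/2).

    Submultiplicativity of the spectral norm gives the upper bound for the joint
    spectral radius.  Since A_(m-j) = A_j^T, the product P = A_h A_(m-h) is
    symmetric with top eigenvalue rho^2, which gives the lower bound.

    The B-cylinder of a word w has length 1/(v u), where (v, u) is the row vector
    (lambda, 1) A_w.  The bound |(v, u)|^2 <= (lambda^2 + 1) rho^(2n) makes it at
    least a constant times rho^(-2n), while the C-cylinder has length (m-1)^(-n);
    as (m-1) = rho^(2 alpha), this gives exponent alpha.  For alternating words
    h, m-h, h, ... the row (lambda, 1) dominates a positive multiple of the
    positive eigenvector of P, so that v u is at least a constant times rho^(2n),
    and no larger exponent is possible. *)

(** * Ordered iterated function systems *)

(** This is the composite inside [cylinder], kept apart from the interval so that endpoints can be
    tracked. *)
Definition prefix_map (T : Type) (F : nat -> T -> T) (w : nat -> nat) (n : nat) :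
    T -> T :=
  \big[comp/idfun]_(0 <= i < n) F (w i).

Lemma prefix_map0 (T : Type) (F : nat -> T -> T) w : prefix_map F w 0 = idfun.
Proof. by rewrite /prefix_map big_geq. Qed.

Lemma prefix_mapS (T : Type) (F : nat -> T -> T) w n :
  prefix_map F w n.+1 = prefix_map F w n \o F (w n).
Proof.
rewrite /prefix_map /index_iota !subn0 -addn1 iotaD /=.
elim: (iota 0 n) => [|i s IH] /=; first by rewrite big_cons !big_nil.
by rewrite !big_cons IH.
Qed.

Lemma eq_prefix_map (T : Type) (F : nat -> T -> T) w w' n :
  (forall i, (i < n)%N -> w i = w' i) -> prefix_map F w n = prefix_map F w' n.
Proof. by move=> ww'; apply: eq_big_nat => i /andP[_ /ww' ->]. Qed.

(** Common abstraction of the B- and C-systems: monotone branches whose images tile [[0, T]] from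
    left to right. [ifs_onto] plays the part of continuity, and [ifs_shrink] asks for small
    cylinders along each digit sequence separately. *)
Record ordered_ifs (R : realType) (m : nat) (F : nat -> R -> R) (T : R) : Prop :=
  OrderedIFS {
  ifs_branches : (3 <= m)%N;
  ifs_ge0 : 0 <= T;
  ifs_homo : forall j, (0 < j < m)%N ->
    {in `[0, T] &, {homo F j : x y / x <= y}};
  ifs_onto : forall j y, (0 < j < m)%N -> F j 0 <= y <= F j T ->
    exists2 x, x \in `[0, T] & F j x = y;
  ifs_first : F 1 0 = 0;
  ifs_last : F m.-1 T = T;
  ifs_adjacent : forall j, (0 < j)%N -> (j.+1 < m)%N -> F j T = F j.+1 0;
  ifs_shrink : forall w, digit_sequence m w -> forall e, 0 < e ->
    exists n, prefix_map F w n T - prefix_map F w n 0 < e }.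

Section IteratedFunctionSystem.
Variables (R : realType) (m : nat) (F : nat -> R -> R) (T : R).
Hypothesis ifsF : ordered_ifs m F T.

Let m_ge3 := ifs_branches ifsF.
Let T_ge0 := ifs_ge0 ifsF.
Let F_homo := ifs_homo ifsF.
Let F_onto := ifs_onto ifsF.
Let F_first := ifs_first ifsF.
Let F_last := ifs_last ifsF.
Let F_adjacent := ifs_adjacent ifsF.

Let zeroI : (0 : R) \in `[0, T]. Proof. by rewrite in_itv /= lexx. Qed.
Let TI : T \in `[0, T]. Proof. by rewrite in_itv /= T_ge0 lexx. Qed.

Lemma F_sep j k : (0 < j)%N -> (j < k)%N -> (k < m)%N -> F j T <= F k 0.
Proof.
move=> j0; elim: k => // k IH; rewrite ltnS leq_eqVlt => /orP[/eqP <-|jk] km.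
  by rewrite F_adjacent.
have k0 : (0 < k)%N by apply: leq_trans jk.
apply: le_trans (IH jk (ltnW km)) _.
by rewrite -F_adjacent//; apply: F_homo => //; rewrite k0 ltnW.
Qed.

Lemma F_ge0 j : (0 < j < m)%N -> 0 <= F j 0.
Proof.
move=> /andP[j0 jm]; have [->|j1] := eqVneq j 1%N; first by rewrite F_first.
have h : (1 < j)%N by case: j j0 j1 {jm} => [|[]].
apply: le_trans (F_sep _ h jm) => //.
rewrite -[X in X <= _]F_first; apply: F_homo => //.
by rewrite /=; apply: leq_trans m_ge3.
Qed.

Lemma F_leT j : (0 < j < m)%N -> F j T <= T.
Proof.
move=> /andP[j0 jm]; have [->|j1] := eqVneq j m.-1; first by rewrite F_last.
have h : (j < m.-1)%N.
  by rewrite ltn_neqAle j1 -ltnS prednK //; apply: leq_ltn_trans jm.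
have mm : (m.-1 < m)%N by rewrite ltn_predL; apply: leq_ltn_trans jm.
apply: le_trans (F_sep j0 h mm) _ => //.
rewrite -[X in _ <= X]F_last; apply: F_homo => //.
by rewrite mm andbT; apply: leq_ltn_trans h.
Qed.

Lemma F_itv j x : (0 < j < m)%N -> x \in `[0, T] -> F j x \in `[0, T].
Proof.
move=> hj xI; move: (xI); rewrite !in_itv /= => /andP[x0 xT].
apply/andP; split.
  by apply: le_trans (F_ge0 hj) _; apply: F_homo.
by apply: le_trans _ (F_leT hj); apply: F_homo.
Qed.

Lemma prefix_map_homo w n : digit_sequence m w ->
  {in `[0, T] &, {homo prefix_map F w n : x y / x <= y}}.
Proof.
move=> dw; elim: n => [|n IH] x y xI yI xy; first by rewrite prefix_map0.
by rewrite prefix_mapS /=; apply: IH; rewrite ?F_itv//; apply: F_homo.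
Qed.

Lemma prefix_map_onto w n y : digit_sequence m w ->
  prefix_map F w n 0 <= y <= prefix_map F w n T ->
  exists2 x, x \in `[0, T] & prefix_map F w n x = y.
Proof.
move=> dw; elim: n y => [|n IH] y.
  by rewrite prefix_map0 /= => yI; exists y; rewrite ?in_itv.
rewrite prefix_mapS /= => /andP[y0 yT].
have [|x xI xy] := IH y.
  apply/andP; split.
    by apply: le_trans y0; apply: prefix_map_homo; rewrite ?F_itv// F_ge0.
  by apply: le_trans yT _; apply: prefix_map_homo; rewrite ?F_itv// F_leT.
(* Monotonicity is only weak, so [x] may miss the image of [F (w n)]. Then [y] is squeezed onto an
   endpoint value, attained at 0 or [T]. *)
have [xl|xl] := ltP x (F (w n) 0).
  exists 0 => //; apply/le_anti/andP; split; first by [].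
  by rewrite -xy; apply: prefix_map_homo; rewrite ?F_itv// ltW.
have [xr|xr] := ltP (F (w n) T) x.
  exists T => //; apply/le_anti/andP; split; last by [].
  by rewrite -xy; apply: prefix_map_homo; rewrite ?F_itv// ltW.
have [z zI zx] := F_onto (dw n) (introT andP (conj xl xr)).
by exists z; rewrite //= zx.
Qed.

Lemma cylinderE w n : digit_sequence m w ->
  cylinder F `[0, T] w n = `[prefix_map F w n 0, prefix_map F w n T]%classic.
Proof.
move=> dw; apply/seteqP; split => [_ [x xI <-]|y yI] /=.
  have xI' : x \in `[0, T] by rewrite inE in xI *.
  move: (xI'); rewrite !in_itv /= => /andP[x0 xT].
  by apply/andP; split; apply: prefix_map_homo.
have [x xI <-] := prefix_map_onto dw yI.
by exists x.
Qed.

Lemma prefix_map0_nd w n k : digit_sequence m w -> (n <= k)%N ->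
  prefix_map F w n 0 <= prefix_map F w k 0.
Proof.
move=> dw /subnKC <-; elim: (k - n)%N => [|i IH]; first by rewrite addn0.
rewrite addnS; apply: le_trans IH _.
by rewrite prefix_mapS; apply: prefix_map_homo; rewrite ?F_itv// F_ge0.
Qed.

Lemma prefix_mapT_ni w n k : digit_sequence m w -> (n <= k)%N ->
  prefix_map F w k T <= prefix_map F w n T.
Proof.
move=> dw /subnKC <-; elim: (k - n)%N => [|i IH]; first by rewrite addn0.
rewrite addnS; apply: le_trans IH.
by rewrite prefix_mapS; apply: prefix_map_homo; rewrite ?F_itv// F_leT.
Qed.

Lemma prefix_map_unique w x y : digit_sequence m w ->
  (forall n, prefix_map F w n 0 <= x <= prefix_map F w n T) ->
  (forall n, prefix_map F w n 0 <= y <= prefix_map F w n T) -> x = y.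
Proof.
move=> dw hx hy; apply/eqP; rewrite -subr_eq0 -normr_le0 leNgt; apply/negP => xy.
have [n] := ifs_shrink ifsF dw xy.
move: (hx n) (hy n) => /andP[h1 h2] /andP[h3 h4].
by apply/negP; rewrite -leNgt ler_norml; apply/andP; split; lra.
Qed.

Lemma prefix_le_cross w n k : digit_sequence m w ->
  prefix_map F w n 0 <= prefix_map F w k T.
Proof.
move=> dw; apply: le_trans (prefix_map0_nd dw (leq_maxl n k)) _.
apply: le_trans (prefix_mapT_ni dw (leq_maxr n k)).
exact: prefix_map_homo.
Qed.

Lemma coding_eq w x : digit_sequence m w ->
  (forall n, prefix_map F w n 0 <= x <= prefix_map F w n T) ->
  coding F `[0, T] w = x.
Proof.
move=> dw hx; have e : \bigcap_n cylinder F `[0, T] w n = [set x].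
  apply/seteqP; split => [y yI|y ->] /=; last first.
    by move=> n _; rewrite cylinderE //=; apply: hx.
  apply: (prefix_map_unique dw) => // n.
  by have := yI n Logic.I; rewrite cylinderE //= in_itv.
rewrite /coding; case: xgetP => [y _ /= |/(_ x)//].
by rewrite e => /seteqP[/(_ x erefl)].
Qed.

(** Cylinders are nested, so the supremum of their left endpoints lies in all of them; by
    [coding_eq] it is the coded point. *)
Lemma coding_mem w n : digit_sequence m w ->
  prefix_map F w n 0 <= coding F `[0, T] w <= prefix_map F w n T.
Proof.
move=> dw; pose x := sup (range (fun n => prefix_map F w n 0)).
have hx k : prefix_map F w k 0 <= x <= prefix_map F w k T.
  apply/andP; split.
    apply: ub_le_sup; last by exists k; rewrite ?in_setT.
    by exists (prefix_map F w 0 T) => _ [i _ <-]; apply: prefix_le_cross.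
  apply: ge_sup; first by exists (prefix_map F w 0 0), 0%N.
  by move=> _ [i _ <-]; apply: prefix_le_cross.
by rewrite (coding_eq dw hx).
Qed.

(** Greedy expansion: the digit of [y] is the least [j] with [y <= F j T], and the expansion
    continues from a preimage of [y] under [F j]. *)
Lemma coding_onto x : x \in `[0, T] ->
  exists2 w, digit_sequence m w & coding F `[0, T] w = x.
Proof.
move=> xI.
(* The membership of [y] is a premise inside the existential, so that [choice] yields a total
   function; [(0, y)] is a dummy value. *)
have step (y : R) : exists p : nat * R, y \in `[0, T] ->
    [/\ (0 < p.1 < m)%N, p.2 \in `[0, T] & F p.1 p.2 = y].
  have [yI|] := boolP (y \in `[0, T]); last by exists (0%N, y).
  have : exists j, [&& (0 < j < m)%N & y <= F j T].
    exists m.-1; rewrite F_last; move: yI; rewrite in_itv /= => /andP[_ ->].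
    by rewrite andbT; move: m_ge3; lia.
  move=> /[dup] /ex_minnP [j /andP[hj yj] jmin] _.
  have yj0 : F j 0 <= y.
    have [j1|j1] := eqVneq j 1%N.
      by rewrite j1 F_first; move: yI; rewrite in_itv => /andP[].
    have [j' ej] : exists j', j = j'.+2.
      by case: j hj j1 {yj jmin} => [|[|k]]// _ _; exists k.
    subst j; rewrite -(F_adjacent _ (andP hj).2)//.
    (* Since [F j 0] is the right end of the preceding branch, a smaller [y] would contradict the
       minimality of [j]. *)
    rewrite leNgt; apply/negP => /ltW h.
    have := jmin j'.+1; rewrite h andbT /= ltnn.
    by move=> h1; have := h1 (ltnW (andP hj).2).
  have [z zI zy] := F_onto hj (introT andP (conj yj0 yj)).
  by exists (j, z).
have [f fP] := choice step.
pose y n := iter n (fun z => (f z).2) x; pose w n := (f (y n)).1.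
have yI n : y n \in `[0, T] by elim: n => //= n /fP[].
have dw : digit_sequence m w by move=> n; have [] := fP _ (yI n).
exists w => //; apply: coding_eq => // n.
have <- : prefix_map F w n (y n) = x.
  elim: n => [|n IH]; first by rewrite prefix_map0.
  by rewrite prefix_mapS /= -[RHS]IH; have [_ _ ->] := fP _ (yI n).
have := yI n; rewrite in_itv /= => /andP[y0 yT].
by apply/andP; split; apply: prefix_map_homo; rewrite ?yI.
Qed.

Lemma prefix_sep w w' i : digit_sequence m w -> digit_sequence m w' ->
  (forall k, (k < i)%N -> w k = w' k) -> (w i < w' i)%N ->
  prefix_map F w i.+1 T <= prefix_map F w' i.+1 0.
Proof.
move=> dw dw' ww' wi; rewrite !prefix_mapS /= (eq_prefix_map F ww').
apply: prefix_map_homo; rewrite ?F_itv//.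
by apply: F_sep => //; [case/andP: (dw i)|case/andP: (dw' i)].
Qed.

End IteratedFunctionSystem.

Lemma first_difference (w w' : nat -> nat) n :
  (forall i, (i < n)%N -> w i = w' i) \/
  exists i, [/\ (i < n)%N, forall k, (k < i)%N -> w k = w' k & w i != w' i].
Proof.
have [h|h] := pselect (exists i, (i < n)%N && (w i != w' i)); [right|left].
  have [i /andP[i_n wi] imin] := ex_minnP h; exists i; split => // k ki.
  apply/eqP/negPn/negP => wk.
  by have := imin k; rewrite wk (ltn_trans ki i_n) /= leqNgt ki => /(_ isT).
by move=> i i_n; apply/eqP/negPn/negP => wi; apply: h; exists i; rewrite i_n.
Qed.

(** * Transfer of order between two codings *)

Section Conjugacy.
Variables (R : realType) (m : nat).
Implicit Types (F G : nat -> R -> R) (T U x y : R) (w : nat -> nat).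

(* Both sides are decided at the first index where [w] and [w'] differ; this
   makes it unnecessary to know which codes represent the same point. *)
Lemma coding_lt_prefix F G T U w w' n : ordered_ifs m F T -> ordered_ifs m G U ->
  digit_sequence m w -> digit_sequence m w' ->
  coding G `[0, U] w < prefix_map G w' n 0 ->
  coding F `[0, T] w <= prefix_map F w' n 0.
Proof.
move=> ifsF ifsG dw dw' lt_w_w'.
have [h|[i [i_n ww' wi]]] := first_difference w w' n.
  have /andP[] := coding_mem ifsG n dw.
  by rewrite (eq_prefix_map _ h) leNgt lt_w_w'.
have {wi} [wi|wi] : (w i < w' i)%N \/ (w' i < w i)%N.
- by move: wi; rewrite neq_ltn => /orP[]; [left|right].
- have /andP[_ h] := coding_mem ifsF i.+1 dw.
  apply: le_trans h _; apply: le_trans (prefix_sep ifsF dw dw' ww' wi) _.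
  exact: (prefix_map0_nd ifsF dw' i_n).
- have w'w k : (k < i)%N -> w' k = w k by move=> /ww'.
  have /andP[h _] := coding_mem ifsG i.+1 dw.
  have := le_trans (prefix_sep ifsG dw' dw w'w wi) h.
  move=> /(le_trans (prefix_le_cross ifsG n i.+1 dw')).
  by rewrite leNgt lt_w_w'.
Qed.

Lemma coding_gt_prefix F G T U w w' n : ordered_ifs m F T -> ordered_ifs m G U ->
  digit_sequence m w -> digit_sequence m w' ->
  prefix_map G w' n U < coding G `[0, U] w ->
  prefix_map F w' n T <= coding F `[0, T] w.
Proof.
move=> ifsF ifsG dw dw' lt_w'_w.
have [h|[i [i_n ww' wi]]] := first_difference w w' n.
  have /andP[_] := coding_mem ifsG n dw.
  by rewrite (eq_prefix_map _ h) leNgt lt_w'_w.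
have {wi} [wi|wi] : (w i < w' i)%N \/ (w' i < w i)%N.
- by move: wi; rewrite neq_ltn => /orP[]; [left|right].
- have /andP[_ h] := coding_mem ifsG i.+1 dw.
  have := le_trans h (prefix_sep ifsG dw dw' ww' wi).
  move=> /le_trans /(_ (prefix_le_cross ifsG i.+1 n dw')).
  by rewrite leNgt lt_w'_w.
- have w'w k : (k < i)%N -> w' k = w k by move=> /ww'.
  have /andP[h _] := coding_mem ifsF i.+1 dw.
  apply: le_trans _ h; apply: le_trans _ (prefix_sep ifsF dw' dw w'w wi).
  exact: (prefix_mapT_ni ifsF dw' i_n).
Qed.

(** The Minkowski function is the instance from the B-system to the C-system, by conversion. *)
Definition recoding F G T U x : R :=
  xget 0 (coding G `[0, U] @`
    (digit_sequence m `&` coding F `[0, T] @^-1` [set x])).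

Lemma recodingP F G T U x : ordered_ifs m F T -> x \in `[0, T] ->
  exists w, [/\ digit_sequence m w, coding F `[0, T] w = x &
    coding G `[0, U] w = recoding F G T U x].
Proof.
move=> ifsF xI; rewrite /recoding; case: xgetP => [y _ /= [w [dw wx] wy]|].
  by exists w.
have [w dw wx] := coding_onto ifsF xI.
by move=> /(_ (coding G `[0, U] w)) /= []; exists w.
Qed.

(** A value outside the G-cylinder would, by the two comparison lemmas, push [x] out of the open
    F-cylinder. *)
Lemma recoding_interior F G T U w n x : ordered_ifs m F T -> ordered_ifs m G U ->
  digit_sequence m w -> x \in `[0, T] ->
  prefix_map F w n 0 < x < prefix_map F w n T ->
  prefix_map G w n 0 <= recoding F G T U x <= prefix_map G w n U.
Proof.
move=> ifsF ifsG dw xI /andP[lx xr].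
have [w' [dw' w'x <-]] := recodingP G U ifsF xI.
apply/andP; split; rewrite leNgt; apply/negP => h.
  have := coding_lt_prefix ifsF ifsG dw' dw h.
  by rewrite w'x leNgt lx.
have := coding_gt_prefix ifsF ifsG dw' dw h.
by rewrite w'x leNgt xr.
Qed.

(** For the Hölder bound: values on either side of a G-cylinder come from points on either side of
    the F-cylinder of the same word. *)
Lemma recoding_between F G T U w n x x' : ordered_ifs m F T -> ordered_ifs m G U ->
  digit_sequence m w -> x \in `[0, T] -> x' \in `[0, T] ->
  recoding F G T U x < prefix_map G w n 0 ->
  prefix_map G w n U < recoding F G T U x' ->
  prefix_map F w n T - prefix_map F w n 0 <= x' - x.
Proof.
move=> ifsF ifsG dw xI xI'.
have [v [dv vx <-]] := recodingP G U ifsF xI.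
have [v' [dv' vx' <-]] := recodingP G U ifsF xI'.
move=> /(coding_lt_prefix ifsF ifsG dv dw) + /(coding_gt_prefix ifsF ifsG dv' dw).
by rewrite vx vx' => h1 h2; apply: lerB.
Qed.

Lemma recoding_itv F G T U x : ordered_ifs m F T -> ordered_ifs m G U ->
  x \in `[0, T] -> recoding F G T U x \in `[0, U].
Proof.
move=> ifsF ifsG xI; have [v [dv vx <-]] := recodingP G U ifsF xI.
by have := coding_mem ifsG 0%N dv; rewrite prefix_map0 in_itv.
Qed.

End Conjugacy.

(** * Matrices of size two *)

Section TwoByTwo.
Variable R : realType.
Implicit Types a b c d : R.

Lemma mx2_00 a b c d : mx2 a b c d 0 0 = a. Proof. by rewrite mxE. Qed.
Lemma mx2_01 a b c d : mx2 a b c d 0 1 = b. Proof. by rewrite mxE. Qed.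
Lemma mx2_10 a b c d : mx2 a b c d 1 0 = c. Proof. by rewrite mxE. Qed.
Lemma mx2_11 a b c d : mx2 a b c d 1 1 = d. Proof. by rewrite mxE. Qed.
Definition mx2E := (mx2_00, mx2_01, mx2_10, mx2_11).

Lemma mx2P (T : Type) (M N : 'M[T]_2) : M 0 0 = N 0 0 -> M 0 1 = N 0 1 ->
  M 1 0 = N 1 0 -> M 1 1 = N 1 1 -> M = N.
Proof.
move=> h00 h01 h10 h11; apply/matrixP => i j.
have ord2 (k : 'I_2) : k = 0 \/ k = 1.
  by case: k => [[|[|k]] hk]//; [left|right]; apply: val_inj.
by have [->|->] := ord2 i; have [->|->] := ord2 j.
Qed.

Lemma mulmx2E (K : pzSemiRingType) p (M : 'M[K]_2) (N : 'M[K]_(2, p)) i j :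
  (M *m N) i j = M i 0 * N 0 j + M i 1 * N 1 j.
Proof.
rewrite mxE big_ord_recl big_ord1.
by congr (_ + M _ _ * N _ _); apply: val_inj.
Qed.

Lemma mul_mx2 a b c d a' b' c' d' : mx2 a b c d * mx2 a' b' c' d' =
  mx2 (a * a' + b * c') (a * b' + b * d') (c * a' + d * c') (c * b' + d * d').
Proof. by apply: mx2P; rewrite mulmx2E !mx2E. Qed.

Lemma mx2_1 : 1 = mx2 1 0 0 1 :> 'M[R]_2.
Proof. by apply: mx2P; rewrite !mxE. Qed.

Lemma inv_mx2 a b c d : a * d - b * c = 1 -> (mx2 a b c d)^-1 = mx2 d (- b) (- c) a.
Proof.
move=> h; have e : mx2 a b c d * mx2 d (- b) (- c) a = 1.
  by rewrite mul_mx2 mx2_1; apply: mx2P; rewrite !mx2E; lra.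
have u : mx2 a b c d \is a GRing.unit.
  apply/unitrP; exists (mx2 d (- b) (- c) a); split => //.
  by rewrite mul_mx2 mx2_1; apply: mx2P; rewrite !mx2E; lra.
by rewrite -[LHS]mulr1 -e mulKr.
Qed.

(** With D the matrix, [mu - D^T D] is positive semidefinite: its trace is at least [mu - mu^-1],
    and its determinant is [mu^2 - mu tr(D^T D) + 1], nonnegative by the trace bound. *)
Lemma sqnorm_mx2_le a b c d mu x y : a * d - b * c = 1 -> 1 <= mu ->
  a ^+ 2 + b ^+ 2 + c ^+ 2 + d ^+ 2 <= mu + mu^-1 ->
  (a * x + b * y) ^+ 2 + (c * x + d * y) ^+ 2 <= mu * (x ^+ 2 + y ^+ 2).
Proof.
move=> det mu1 tr.
have mu0 : 0 < mu by lra.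
have muV : mu * mu^-1 = 1 by rewrite divff// gt_eqF.
have V1 : mu^-1 <= 1 by rewrite invf_le1.
set p := a ^+ 2 + c ^+ 2; set q := a * b + c * d; set r := b ^+ 2 + d ^+ 2.
have hT : p + r <= mu + mu^-1 by rewrite /p /r; lra.
have hdet : p * r - q ^+ 2 = 1 by rewrite -(expr1n _ 2) -det /p /q /r; ring.
have hq : q ^+ 2 <= (mu - p) * (mu - r).
  suff : (p + r) * mu <= mu ^+ 2 + 1 by nra.
  have : (p + r) * mu <= (mu + mu^-1) * mu by rewrite ler_pM2r.
  by rewrite [X in _ <= X]mulrDl mulVf ?gt_eqF// -expr2.
suff h : 0 <= (mu - p) * x ^+ 2 - 2 * q * (x * y) + (mu - r) * y ^+ 2.
  rewrite -subr_ge0; move: h; rewrite /p /q /r.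
  set X := (X in 0 <= X -> _) => h; set Y := (Y in 0 <= Y).
  by have -> : Y = X by rewrite /X /Y; ring.
have q2 : 0 <= q ^+ 2 by rewrite sqr_ge0.
have P0 : 0 <= (mu - p) + (mu - r) by lra.
have pp : 0 <= mu - p.
  rewrite leNgt; apply/negP => h.
  have hr : 0 < mu - r by lra.
  by have := mulr_gt0 hr (ltac:(lra) : 0 < - (mu - p)); lra.
move: hq pp P0; set u := mu - p; set v := mu - r => hq u0 uv.
(* If [u = 0] the form reduces to [v * y ^+ 2]; otherwise multiply by [u] and complete the
   square. *)
have [u00|u00] := eqVneq u 0.
  have v0 : 0 <= v by lra.
  have -> : q = 0.
    by apply/eqP; rewrite -sqrf_eq0 eq_le q2 andbT; move: hq; rewrite u00 mul0r.
  by rewrite u00; have := sqr_ge0 y; nra.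
have u_gt : 0 < u by rewrite lt_neqAle eq_sym u00.
rewrite -(pmulr_rge0 _ u_gt).
have -> : u * (u * x ^+ 2 - 2 * q * (x * y) + v * y ^+ 2) =
  (u * x - q * y) ^+ 2 + (u * v - q ^+ 2) * y ^+ 2 by ring.
by apply: addr_ge0; rewrite ?sqr_ge0// mulr_ge0 ?sqr_ge0// subr_ge0.
Qed.

End TwoByTwo.

(** * Spectral radius of a matrix of size two and determinant one *)

Section SpectralNorm.
Variable R : realType.
Local Notation normC := (@ComplexField.Normc.normc R).


Lemma det_mx2 (K : comPzRingType) (M : 'M[K]_2) :
  \det M = M 0 0 * M 1 1 - M 0 1 * M 1 0.
Proof.
rewrite (expand_det_row _ 0) big_ord_recl big_ord1 /cofactor !det_mx11 !mxE /=.
rewrite expr0 expr1 mul1r mulN1r mulrN.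
by congr (_ * M _ _ - M _ _ * M _ _); apply: val_inj.
Qed.

Lemma eigenvalue_mx2 (K : fieldType) (M : 'M[K]_2) (z : K) :
  eigenvalue M z =
  (z ^+ 2 - (M 0 0 + M 1 1) * z + (M 0 0 * M 1 1 - M 0 1 * M 1 0) == 0).
Proof.
have -> : eigenvalue M z = (\det (M - z%:M) == 0).
  apply/eigenvalueP/det0P => [[v vM v0]|[v v0 vM]]; exists v => //.
    by rewrite mulmxBr vM mul_mx_scalar subrr.
  by apply/eqP; rewrite -subr_eq0 -mul_mx_scalar -mulmxBr vM.
rewrite det_mx2 !mxE /= mulr1n mulr0n; congr (_ == 0); ring.
Qed.

Lemma normc_real (x : R) : normC x%:C%C = `|x|.
Proof. by rewrite /ComplexField.Normc.normc /= expr0n addr0 sqrtr_sqr. Qed.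

(** The characteristic polynomial factors as (z - mu)(z - 1/mu), and mu is the larger root. *)
Lemma spectral_radius_mx2 (M : 'M[R]_2) (mu : R) : 1 <= mu ->
  M 0 0 + M 1 1 = mu + mu^-1 -> M 0 0 * M 1 1 - M 0 1 * M 1 0 = 1 ->
  spectral_radius M = mu.
Proof.
move=> mu1 tr det; have mu0 : 0 < mu by lra.
have mun0 : mu != 0 by rewrite gt_eqF.
have V1 : mu^-1 <= 1 by rewrite invf_le1.
have V0 : 0 < mu^-1 by rewrite invr_gt0.
have eigE z : eigenvalue (map_mx (real_complex R) M) z =
    (z == mu%:C%C) || (z == (mu^-1)%:C%C).
  rewrite eigenvalue_mx2 !mxE -(subr_eq0 z mu%:C%C) -(subr_eq0 z (mu^-1)%:C%C).
  rewrite -mulf_eq0; congr (_ == 0).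
  have trC : (M 0 0)%:C%C + (M 1 1)%:C%C = mu%:C%C + (mu^-1)%:C%C.
    by rewrite -!rmorphD /= tr.
  have detC : (M 0 0)%:C%C * (M 1 1)%:C%C - (M 0 1)%:C%C * (M 1 0)%:C%C = 1.
    by rewrite -!rmorphM -rmorphB /= det.
  have muVC : mu%:C%C * (mu^-1)%:C%C = 1 by rewrite -rmorphM /= divff.
  rewrite trC detC -muVC; ring.
rewrite /spectral_radius; apply/le_anti/andP; split.
  apply: ge_sup; first by exists mu, mu%:C%C;
    [rewrite /= eigE eqxx|rewrite normc_real gtr0_norm].
  move=> _ [z /= + <-]; rewrite eigE => /orP[] /eqP ->;
    rewrite normc_real gtr0_norm//.
  by lra.
apply: ub_le_sup; last by exists mu%:C%C;
  [rewrite /= eigE eqxx|rewrite normc_real gtr0_norm].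
exists mu => _ [z /= + <-]; rewrite eigE => /orP[] /eqP ->;
  rewrite normc_real gtr0_norm//.
by lra.
Qed.
End SpectralNorm.

(** * The generators *)

Section Generators.
Variables (R : realType) (m : nat).
Hypothesis m_ge3 : (3 <= m)%N.
Local Notation lam := (lambda R m).
Local Notation theta := (pi / m%:R : R).

(** For positive [j], the Chebyshev polynomial of the second kind of degree [j - 1], evaluated at
    cos(pi/m) = lambda/2. *)
Definition cheb (j : nat) : R := sin (j%:R * theta) / sin theta.

Let m_gt0 : (0 : R) < m%:R. Proof. by rewrite ltr0n; lia. Qed.
Let mtheta : m%:R * theta = pi. Proof. by rewrite mulrC divfK// gt_eqF. Qed.
Let theta_gt0 : 0 < theta. Proof. by rewrite divr_gt0// pi_gt0. Qed.

Let theta_le j k : (j <= k)%N -> j%:R * theta <= k%:R * theta.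
Proof. by move=> jk; rewrite ler_pM2r// ler_nat. Qed.

Let sin_theta_gt0 : 0 < sin theta.
Proof.
apply: sin_gt0_pi; rewrite theta_gt0 /= -[X in _ < X]mtheta -[X in X < _]mul1r.
by rewrite ltr_pM2r// ltr1n; lia.
Qed.

Lemma cheb0 : cheb 0 = 0. Proof. by rewrite /cheb mul0r sin0 mul0r. Qed.
Lemma cheb1 : cheb 1 = 1. Proof. by rewrite /cheb mul1r divff// gt_eqF. Qed.

Lemma chebSS j : cheb j.+2 = lam * cheb j.+1 - cheb j.
Proof.
rewrite /cheb [lam * (_ / _)]mulrA -mulrBl; congr (_ / _).
have -> : j.+2%:R * theta = j.+1%:R * theta + theta by rewrite -(natr1 j.+1); ring.
have -> : j%:R * theta = j.+1%:R * theta - theta by rewrite -(natr1 j); ring.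
by rewrite sinD sinB /lambda; ring.
Qed.

Lemma cheb_det j : cheb j.+1 ^+ 2 - cheb j * cheb j.+2 = 1.
Proof.
elim: j => [|j <-]; first by rewrite cheb0 cheb1; ring.
by rewrite (chebSS j.+1) (chebSS j); ring.
Qed.

Lemma cheb_sym j : (j <= m)%N -> cheb (m - j) = cheb j.
Proof.
move=> jm; rewrite /cheb natrB// mulrBl mtheta sinB sinpi cospi.
by congr (_ / _); ring.
Qed.

Lemma cheb_mono j k : (j <= k)%N -> (k <= m./2)%N -> cheb j <= cheb k.
Proof.
move=> jk km; rewrite ler_pM2r ?invr_gt0//.
have hpi : k%:R * theta <= pi / 2.
  have : (k * 2)%:R * theta <= m%:R * theta by apply: theta_le; lia.
  by rewrite mtheta natrM; lra.
have j0 : 0 <= j%:R * theta by rewrite mulr_ge0// ltW.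
have [->//|jk'] := eqVneq j k.
apply/ltW; rewrite ltr_sin ?ltr_pM2r// ?ltr_nat ?in_itv /=.
- by rewrite ltn_neqAle jk'.
- have := theta_le jk; have := pi_ge0 R; lra.
- have := theta_le jk; have := pi_ge0 R; lra.
Qed.

Lemma cheb_le_max j : (j <= m)%N -> cheb j <= cheb m./2.
Proof.
move=> jm; have [jh|jh] := leqP j m./2; first exact: cheb_mono.
by rewrite -(cheb_sym jm); apply: cheb_mono => //; lia.
Qed.

Lemma cheb_ge1 j : (0 < j < m)%N -> 1 <= cheb j.
Proof.
rewrite -cheb1 => /andP[j0 jm]; have [jh|jh] := leqP j m./2; first exact: cheb_mono.
by rewrite -(cheb_sym (ltnW jm)); apply: cheb_mono; lia.
Qed.

Lemma cheb_ge0 j : (j <= m)%N -> 0 <= cheb j.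
Proof.
move=> jm; have [->|j0] := posnP j; first by rewrite cheb0.
have [->|jm'] := eqVneq j m; first by rewrite -(cheb_sym (leqnn m)) subnn cheb0.
by apply: le_trans (cheb_ge1 _); rewrite // j0 ltn_neqAle jm'.
Qed.

(** By the recurrence, lambda is [cheb 2]. *)
Lemma lambda_ge1 : 1 <= lam.
Proof. by have := @cheb_ge1 2 m_ge3; rewrite chebSS cheb1 cheb0; lra. Qed.

Lemma matRE : matR R m = mx2 0 (-1) 1 lam.
Proof.
rewrite /matR /matL /matS inv_mx2 ?mul_mx2; last by ring.
by apply: mx2P; rewrite !mx2E; ring.
Qed.

Lemma matR_invX j : matR R m ^- j.+1 =
  mx2 (cheb j.+2) (cheb j.+1) (- cheb j.+1) (- cheb j).
Proof.
rewrite -exprVn matRE inv_mx2; last by ring.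
elim: j => [|j IH].
  by rewrite expr1 chebSS cheb1 cheb0; apply: mx2P; rewrite !mx2E; ring.
rewrite exprSr IH mul_mx2; apply: mx2P;
  by rewrite !mx2E ?(chebSS j.+1) ?(chebSS j); ring.
Qed.

Lemma matAE j : matA R m j.+1 = mx2 (cheb j.+1) (cheb j) (cheb j.+2) (cheb j.+1).
Proof.
by rewrite /matA matR_invX /matS mul_mx2; apply: mx2P; rewrite !mx2E; ring.
Qed.

(* The left-hand side is the squared Frobenius norm of [matA j.+1]. *)
Lemma cheb_sqnorm j :
  cheb j.+1 ^+ 2 + cheb j ^+ 2 + cheb j.+2 ^+ 2 + cheb j.+1 ^+ 2 =
  2 + (lam * cheb j.+1) ^+ 2.
Proof. by have := cheb_det j; rewrite chebSS; lra. Qed.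

Lemma rho_spec : 1 < rho R m /\
  rho R m ^+ 2 + (rho R m ^+ 2)^-1 = 2 + (lam * cheb m./2) ^+ 2.
Proof.
have [h hE] : exists h, m./2 = h.+1 by exists m./2.-1; lia.
set t := 2 + _.
have t2 : 2 < t.
  rewrite /t ltrDl exprn_gt0// mulr_gt0//; first exact: lt_le_trans lambda_ge1.
  by apply: lt_le_trans (cheb_ge1 _) => //; lia.
(* The larger root of z^2 - t z + 1, the characteristic polynomial of [A^T A] for [A = matA m./2],
   whose trace is [t]. *)
pose mu := (t + Num.sqrt (t ^+ 2 - 4)) / 2.
have d0 : 0 <= t ^+ 2 - 4 by nra.
have sq : Num.sqrt (t ^+ 2 - 4) ^+ 2 = t ^+ 2 - 4 by rewrite sqr_sqrtr.
have sq0 := sqrtr_ge0 (t ^+ 2 - 4).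
have mu1 : 1 < mu by rewrite /mu; lra.
have muq : mu * (t - mu) = 1.
  have -> : mu * (t - mu) = (t ^+ 2 - Num.sqrt (t ^+ 2 - 4) ^+ 2) / 4.
    by rewrite /mu; field.
  by rewrite sq; field.
have mun0 : mu != 0 by rewrite gt_eqF// (lt_trans _ mu1).
have muV : mu^-1 = t - mu by rewrite -[LHS]mulr1 -muq mulKf.
have muS : mu + mu^-1 = t by rewrite muV; ring.
have rhoE : rho R m = Num.sqrt mu.
  rewrite /rho /spectral_norm hE matAE (@spectral_radius_mx2 _ _ mu) ?(ltW mu1)//.
    rewrite !mulmx2E ![(_^T)%R _ _]mxE !mx2E muS /t hE -cheb_sqnorm; ring.
  rewrite !mulmx2E ![(_^T)%R _ _]mxE !mx2E.
  by have := cheb_det h => e; rewrite -[RHS](expr1n _ 2) -e; ring.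
have r2 : rho R m ^+ 2 = mu by rewrite rhoE sqr_sqrtr// ltW// (lt_trans _ mu1).
split; last by rewrite r2.
by rewrite rhoE -sqrtr1 ltr_sqrt// (lt_trans _ mu1).
Qed.

Let mu := rho R m ^+ 2.

Lemma rho2_gt1 : 1 < mu.
Proof. by have [h _] := rho_spec; rewrite /mu exprn_egt1. Qed.

(** The squared Frobenius norm grows with [cheb j], hence is at most its value [mu + mu^-1] at
    [j = m./2]. *)
Lemma matA_sqnorm_le j x y : (0 < j < m)%N ->
  (matA R m j 0 0 * x + matA R m j 0 1 * y) ^+ 2 +
  (matA R m j 1 0 * x + matA R m j 1 1 * y) ^+ 2 <= mu * (x ^+ 2 + y ^+ 2).
Proof.
case: j => // j jm; rewrite matAE !mx2E; apply: sqnorm_mx2_le.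
- by rewrite -expr2 cheb_det.
- exact: ltW rho2_gt1.
- have [_ ->] := rho_spec; rewrite cheb_sqnorm lerD2l.
  have l0 : 0 <= lam by apply: le_trans lambda_ge1.
  have cj0 : 0 <= cheb j.+1 by apply: cheb_ge0; lia.
  have cjm : cheb j.+1 <= cheb m./2 by apply: cheb_le_max; lia.
  have cm0 : 0 <= cheb m./2 by apply: le_trans cjm.
  have lcj0 : 0 <= lam * cheb j.+1 by rewrite mulr_ge0.
  have lcm0 : 0 <= lam * cheb m./2 by rewrite mulr_ge0.
  by apply: lerXn2r => //; apply: ler_wpM2l.
Qed.

Lemma trmx_matA j : (0 < j < m)%N -> (matA R m j)^T = matA R m (m - j).
Proof.
case: j => // j jm; have -> : (m - j.+1)%N = (m - j.+2).+1 by lia.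
have e i k : (i + k = m)%N -> cheb i = cheb k.
  by move=> ikm; rewrite -(@cheb_sym i) -?ikm ?leq_addr// addKn.
by rewrite !matAE; apply: mx2P; rewrite [LHS]mxE !mx2E; apply: e; lia.
Qed.

End Generators.

(** * Lengths of the B-cylinders *)

Section Moebius.
Variable R : realType.

Lemma moebius_mul (M N : 'M[R]_2) x : N 1 0 * x + N 1 1 != 0 ->
  moebius (M * N) x = moebius M (moebius N x).
Proof.
move=> d0; rewrite /moebius !mulmx2E.
set n := N 0 0 * x + N 0 1; set d := N 1 0 * x + N 1 1 in d0 *.
have -> : M 0 0 * (n / d) + M 0 1 = (M 0 0 * n + M 0 1 * d) / d by field.
have -> : M 1 0 * (n / d) + M 1 1 = (M 1 0 * n + M 1 1 * d) / d by field.
rewrite invf_div mulrA [_ / d * d]mulrAC -mulrA divff// mulr1 -/n -/d.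
by congr (_ / _); rewrite /n /d; ring.
Qed.

End Moebius.

Local Opaque lambda cheb rho.

(** * Products of generators and the row vector (lambda, 1) *)

Section Cylinders.
Variables (R : realType) (m : nat).
Hypothesis m_ge3 : (3 <= m)%N.
Local Notation lam := (lambda R m).
Local Notation mu := (rho R m ^+ 2).
Implicit Types (w : nat -> nat) (M : 'M[R]_2).

Let lam1 : 1 <= lam := lambda_ge1 R m_ge3.
Let lam0 : 0 < lam := lt_le_trans ltr01 lam1.

(* [(row0 M, row1 M)] is the row vector [(lambda, 1) *m M]. *)
Definition row0 M : R := lam * M 0 0 + M 1 0.
Definition row1 M : R := lam * M 0 1 + M 1 1.

Lemma row0M M N : row0 (M * N) = row0 M * N 0 0 + row1 M * N 1 0.
Proof. by rewrite /row0 /row1 !mulmx2E; ring. Qed.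

Lemma row1M M N : row1 (M * N) = row0 M * N 0 1 + row1 M * N 1 1.
Proof. by rewrite /row0 /row1 !mulmx2E; ring. Qed.

Definition conjL M : 'M[R]_2 := matL R m * M * (matL R m)^-1.

Lemma conjLE M : conjL M = mx2 (M 0 0 - lam * M 0 1) (M 0 1)
  (row0 M - lam * row1 M) (row1 M).
Proof.
have -> : M = mx2 (M 0 0) (M 0 1) (M 1 0) (M 1 1) by apply: mx2P; rewrite !mx2E.
rewrite /conjL /row0 /row1 /matL inv_mx2; last by ring.
by rewrite !mul_mx2; apply: mx2P; rewrite !mx2E; ring.
Qed.

Lemma conjLM M N : conjL (M * N) = conjL M * conjL N.
Proof.
rewrite /conjL !mulrA mulrVK//.
rewrite /matL; apply/unitrP; exists (mx2 1 0 (- lam) 1).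
by rewrite !mul_mx2 mx2_1; split; apply: mx2P; rewrite !mx2E; ring.
Qed.

(** Conjugation by [matL] amounts to letting M act on the homogeneous coordinates (x, 1 - lambda x),
    both nonnegative on the interval. *)
Lemma moebius_conjL M x : moebius (conjL M) x =
  (M 0 0 * x + M 0 1 * (1 - lam * x)) / (row0 M * x + row1 M * (1 - lam * x)).
Proof. by rewrite /moebius conjLE !mx2E; congr (_ / _); ring. Qed.

Lemma moebius_conjL0 M : moebius (conjL M) 0 = M 0 1 / row1 M.
Proof. by rewrite moebius_conjL !mulr0 subr0 !mulr1 !add0r. Qed.

Lemma moebius_conjLT M : moebius (conjL M) lam^-1 = M 0 0 / row0 M.
Proof.
rewrite moebius_conjL divff ?gt_eqF// subrr !mulr0 !addr0.
by rewrite -mulf_div divff ?mulr1// invr_neq0// gt_eqF.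
Qed.

Definition prodA w n : 'M[R]_2 := \prod_(0 <= i < n) matA R m (w i).

Lemma prodAS w n : prodA w n.+1 = prodA w n * matA R m (w n).
Proof. by rewrite /prodA big_nat_recr. Qed.

(** A class closed under products that contains all generators; positive denominators, monotonicity
    and invariance of the interval follow from it. *)
Definition nneg_unimodular M := [/\ 0 <= M 0 0, 0 <= M 0 1, 0 <= M 1 0, 0 <= M 1 1 &
  M 0 0 * M 1 1 - M 0 1 * M 1 0 = 1].

Lemma nneg_unimodularM M N :
  nneg_unimodular M -> nneg_unimodular N -> nneg_unimodular (M * N).
Proof.
move=> [a0 b0 c0 d0 e] [a0' b0' c0' d0' e']; rewrite /nneg_unimodular !mulmx2E.
split; rewrite ?addr_ge0 ?mulr_ge0//.
by rewrite -[RHS](mulr1 1) -[in X in _ = X * _]e -e'; ring.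
Qed.

Lemma matA_nneg j : (0 < j < m)%N -> nneg_unimodular (matA R m j).
Proof.
case: j => // j jm; rewrite /nneg_unimodular matAE// !mx2E.
by split; rewrite ?cheb_ge0 -?expr2 ?cheb_det//; lia.
Qed.

Lemma prodA_nneg w n : digit_sequence m w -> nneg_unimodular (prodA w n).
Proof.
move=> dw; elim: n => [|n IH]; last first.
  by rewrite prodAS; apply: nneg_unimodularM IH (matA_nneg _).
by rewrite /prodA big_geq// mx2_1 /nneg_unimodular !mx2E; split => //; ring.
Qed.

Lemma nneg_row0_gt0 M : nneg_unimodular M -> 0 < row0 M.
Proof.
move=> [a0 b0 c0 d0 e]; rewrite lt0r /row0.
rewrite [X in _ && X]addr_ge0 ?(mulr_ge0 (ltW lam0))//.
rewrite andbT paddr_eq0 ?(mulr_ge0 (ltW lam0))// mulf_eq0 gt_eqF//=.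
by apply/negP => /andP[/eqP a /eqP c]; move: e; rewrite a c; lra.
Qed.

Lemma nneg_row1_gt0 M : nneg_unimodular M -> 0 < row1 M.
Proof.
move=> [a0 b0 c0 d0 e]; rewrite lt0r /row1.
rewrite [X in _ && X]addr_ge0 ?(mulr_ge0 (ltW lam0))//.
rewrite andbT paddr_eq0 ?(mulr_ge0 (ltW lam0))// mulf_eq0 gt_eqF//=.
by apply/negP => /andP[/eqP a /eqP c]; move: e; rewrite a c; lra.
Qed.

(** The rows (M 0 0, M 0 1) and (row0 M, row1 M) are those of [matL * M], again of determinant 1. *)
Lemma row_det M : M 0 0 * M 1 1 - M 0 1 * M 1 0 = 1 ->
  M 0 0 * row1 M - M 0 1 * row0 M = 1.
Proof. by move=> <-; rewrite /row0 /row1; ring. Qed.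

Let itvE x : (x \in `[0, lam^-1]) = (0 <= x) && (0 <= 1 - lam * x).
Proof. by rewrite in_itv /= -[lam^-1]mul1r ler_pdivlMr// [x * _]mulrC subr_ge0. Qed.

Lemma den_gt0 M x : nneg_unimodular M -> x \in `[0, lam^-1] ->
  0 < row0 M * x + row1 M * (1 - lam * x).
Proof.
move=> hM; rewrite itvE => /andP[x0 x1].
have v0 := nneg_row0_gt0 hM; have u0 := nneg_row1_gt0 hM.
have [->|xn0] := eqVneq x 0; first by rewrite !mulr0 subr0 add0r mulr1.
apply: ltr_pwDl; last by rewrite mulr_ge0// ltW.
by rewrite mulr_gt0// lt_neqAle eq_sym xn0.
Qed.

Lemma moebius_conjL_itv M x : nneg_unimodular M -> x \in `[0, lam^-1] ->
  moebius (conjL M) x \in `[0, lam^-1].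
Proof.
move=> hM xI; have d0 := den_gt0 hM xI; have [a0 b0 c0 d0' e] := hM.
move: xI; rewrite itvE => /andP[x0 x1].
rewrite in_itv /= moebius_conjL; apply/andP; split.
  exact: divr_ge0 (addr_ge0 (mulr_ge0 a0 x0) (mulr_ge0 b0 x1)) (ltW d0).
rewrite ler_pdivrMr// -[X in X <= _]mul1r ler_pdivlMl// -subr_ge0.
rewrite /row0 /row1 mul1r.
set X := (X in 0 <= X).
have -> : X = M 1 0 * x + M 1 1 * (1 - lam * x) by rewrite /X; ring.
exact: addr_ge0 (mulr_ge0 c0 x0) (mulr_ge0 d0' x1).
Qed.

Lemma moebius_conjL_homo M : nneg_unimodular M ->
  {in `[0, lam^-1] &, {homo moebius (conjL M) : x y / x <= y}}.
Proof.
move=> hM x y xI yI xy; rewrite !moebius_conjL.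
rewrite ler_pdivrMr ?den_gt0// [X in _ <= X]mulrAC ler_pdivlMr ?den_gt0//.
have [_ _ _ _ /row_det e] := hM.
rewrite -subr_ge0; set X := (X in 0 <= X).
have -> : X = (M 0 0 * row1 M - M 0 1 * row0 M) * (y - x) by rewrite /X; ring.
by rewrite e mul1r subr_ge0.
Qed.

Lemma moebius_conjL_onto M y : nneg_unimodular M ->
  moebius (conjL M) 0 <= y <= moebius (conjL M) lam^-1 ->
  exists2 x, x \in `[0, lam^-1] & moebius (conjL M) x = y.
Proof.
move=> hM; rewrite moebius_conjL0 moebius_conjLT => /andP[].
have u0 := nneg_row1_gt0 hM; have v0 := nneg_row0_gt0 hM.
have [_ _ _ _ /row_det e] := hM.
rewrite ler_pdivrMr// ler_pdivlMr// => h1 h2.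
(* (p, q) is the inverse of [matL * M] applied to (y, 1). Dividing by [q + lam * p] brings it to the
   form (x, 1 - lambda x). *)
set p := y * row1 M - M 0 1; set q := M 0 0 - y * row0 M.
have p0 : 0 <= p by rewrite subr_ge0.
have q0 : 0 <= q by rewrite subr_ge0.
have pq : p * row0 M + q * row1 M = 1 by rewrite -e /p /q; ring.
have D0 : 0 < q + lam * p.
  rewrite lt0r [X in _ && X]addr_ge0 ?(mulr_ge0 (ltW lam0))// andbT.
  rewrite paddr_eq0 ?(mulr_ge0 (ltW lam0))// mulf_eq0 (gt_eqF lam0) /=.
  by apply/negP => /andP[/eqP qz /eqP pz]; move: pq; rewrite qz pz; lra.
have Dn0 : q + lam * p != 0 by rewrite gt_eqF.
have x1 : 1 - lam * (p / (q + lam * p)) = q / (q + lam * p) by field.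
exists (p / (q + lam * p)); first by rewrite itvE x1 !divr_ge0// ltW.
rewrite moebius_conjL x1 !mulrA -!mulrDl.
have -> : row0 M * p + row1 M * q = 1 by rewrite -pq; ring.
have -> : M 0 0 * p + M 0 1 * q = y by rewrite -[RHS]mulr1 -e /p /q; ring.
by rewrite mul1r invrK mulfVK.
Qed.

Lemma prefix_mapB w n x : digit_sequence m w -> x \in `[0, lam^-1] ->
  prefix_map (mapB R m) w n x = moebius (conjL (prodA w n)) x.
Proof.
move=> dw; elim: n x => [|n IH] x xI.
  rewrite prefix_map0 /prodA big_geq// moebius_conjL mx2_1 /row0 /row1 !mx2E.
  by rewrite !mulr0 !mulr1 mul0r mul1r !addr0 add0r mul1r addrC subrK divr1.
have hA := matA_nneg (dw n).
rewrite prefix_mapS /= IH; last exact: moebius_conjL_itv.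
rewrite prodAS conjLM moebius_mul//.
have := den_gt0 hA xI; rewrite lt0r => /andP[+ _]; rewrite conjLE !mx2E.
by congr (~~ (_ == _)); ring.
Qed.

(** The endpoints are [M 0 1 / row1 M] and [M 0 0 / row0 M] for [M = prodA w n]; by [row_det] the
    numerator of their difference is 1. *)
Lemma cylinderB_length w n : digit_sequence m w ->
  prefix_map (mapB R m) w n lam^-1 - prefix_map (mapB R m) w n 0 =
  (row0 (prodA w n) * row1 (prodA w n))^-1.
Proof.
move=> dw; have hP := prodA_nneg n dw.
have l0 : 0 <= lam^-1 by rewrite invr_ge0 ltW.
rewrite !prefix_mapB ?in_itv /= ?lexx ?l0// moebius_conjL0 moebius_conjLT.
have v0 : row0 (prodA w n) != 0 by rewrite gt_eqF// nneg_row0_gt0.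
have u0 : row1 (prodA w n) != 0 by rewrite gt_eqF// nneg_row1_gt0.
have [_ _ _ _ /row_det e] := hP.
by rewrite -[RHS]mul1r -{1}e; field; rewrite v0 u0.
Qed.

Lemma prodA0 w : prodA w 0 = 1. Proof. by rewrite /prodA big_geq. Qed.

Lemma row0_1 : row0 1 = lam. Proof. by rewrite /row0 mx2_1 !mx2E mulr1 addr0. Qed.
Lemma row1_1 : row1 1 = 1. Proof. by rewrite /row1 mx2_1 !mx2E mulr0 add0r. Qed.

(* Replaces uniform contraction, which fails because [mapB 1] and [mapB m.-1]
   are parabolic: at least one off-diagonal entry of a generator is [>= 1], so
   [row0 + row1] gains at least [1] at each step. *)
Lemma row_growth w n : digit_sequence m w ->
  [/\ 1 <= row0 (prodA w n), 1 <= row1 (prodA w n) &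
      n%:R + 2 <= row0 (prodA w n) + row1 (prodA w n)].
Proof.
move=> dw; elim: n => [|n [v1 u1 vu]].
  by rewrite prodA0 row0_1 row1_1; split => //; have := lam1; rewrite ?add0r; lra.
rewrite prodAS row0M row1M; move: v1 u1 vu.
set v := row0 _; set u := row1 _ => v1 u1 vu.
have := dw n; case: (w n) => // j jm; rewrite matAE// !mx2E.
have a1 : 1 <= cheb R m j.+1 by apply: cheb_ge1.
have b0 : 0 <= cheb R m j by apply: cheb_ge0; lia.
have c0 : 0 <= cheb R m j.+2 by apply: cheb_ge0; lia.
have bc : 1 <= cheb R m j + cheb R m j.+2.
  have [->|j0] := posnP j; first by rewrite cheb0 add0r; apply: cheb_ge1.
  by apply: ler_wpDr => //; apply: cheb_ge1; lia.
rewrite -natr1.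
set a := cheb R m j.+1 in a1 *; set b := cheb R m j in b0 bc *.
set c := cheb R m j.+2 in c0 bc *.
have va : v <= v * a by rewrite ler_peMr//; lra.
have ua : u <= u * a by rewrite ler_peMr//; lra.
have vb : b <= v * b by rewrite ler_peMl.
have uc : c <= u * c by rewrite ler_peMl.
by split; lra.
Qed.

Lemma row_sqnorm_le w n : digit_sequence m w ->
  row0 (prodA w n) ^+ 2 + row1 (prodA w n) ^+ 2 <= (lam ^+ 2 + 1) * mu ^+ n.
Proof.
move=> dw; elim: n => [|n IH].
  by rewrite prodA0 row0_1 row1_1 expr1n expr0 mulr1.
rewrite prodAS row0M row1M [mu ^+ n.+1]exprS [X in _ <= X]mulrCA.
apply: le_trans (ler_wpM2l (sqr_ge0 _) IH).
(* A row times [matA (w n)] is the transpose, [matA (m - w n)], acting on a column, so the column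
   estimate applies. *)
have hj : (0 < m - w n < m)%N by have := dw n; lia.
have := @matA_sqnorm_le R m m_ge3 _ (row0 (prodA w n)) (row1 (prodA w n)) hj.
rewrite -trmx_matA// ![(_^T)%R _ _]mxE.
by rewrite ![row0 _ * _]mulrC ![row1 _ * _]mulrC.
Qed.

Lemma extremal_eigenvector : let M := matA R m m./2 * matA R m (m - m./2) in
  M^T = M /\ exists e1 e2, [/\ 0 < e1, 0 < e2,
    e1 * M 0 0 + e2 * M 1 0 = mu * e1 & e1 * M 0 1 + e2 * M 1 1 = mu * e2].
Proof.
rewrite /= -trmx_matA//; last by lia.
have [h hE] : exists h, m./2 = h.+1 by exists m./2.-1; lia.
split; first by rewrite trmx_mul trmxK.
have [_ tr] := rho_spec R m_ge3; have mu1 := rho2_gt1 R m_ge3.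
have det := @cheb_det R m m_ge3 h; move: tr.
rewrite hE -cheb_sqnorm// matAE// !mulmx2E ![(_^T)%R _ _]mxE !mx2E => tr.
have a1 : 1 <= cheb R m h.+1 by apply: cheb_ge1 => //; lia.
have b0 : 0 <= cheb R m h by apply: cheb_ge0 => //; lia.
have c1 : 1 <= cheb R m h.+2 by apply: cheb_ge1 => //; lia.
move: (cheb R m h.+1) (cheb R m h) (cheb R m h.+2) a1 b0 c1 tr det.
move=> a b c a1 b0 c1 tr det.
set p := a * a + b * b; set r := c * c + a * a; set q := c * a + a * b.
have q0 : 0 < q by rewrite /q; nra.
have qE : a * c + b * a = q by rewrite /q; ring.
have prq : p * r - q ^+ 2 = 1 by rewrite -(expr1n _ 2) -det /p /q /r; ring.
have mu0 : mu != 0 by rewrite gt_eqF// (lt_trans _ mu1).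
have V1 : mu^-1 < 1 by rewrite invf_lt1// (lt_trans _ mu1).
have prE : p + r = mu + mu^-1 by rewrite tr /p /r; ring.
(* The product [[[p, q], [q, r]]] has trace [mu + mu^-1] and determinant 1, so mu is an eigenvalue,
   with eigenvector (q, mu - p). *)
have qq : (mu - p) * (mu - r) = q ^+ 2.
  have -> : r = mu + mu^-1 - p by rewrite -prE; ring.
  have : p * (mu + mu^-1 - p) - q ^+ 2 = 1 by rewrite -prq -prE; ring.
  have muV : mu * mu^-1 = 1 by rewrite divff.
  by nra.
have mp : 0 < mu - p.
  have q2 : 0 < q ^+ 2 by rewrite exprn_gt0.
  (* The factors [mu - p] and [mu - r] have positive sum [mu - mu^-1], so if the first were
     nonpositive their product could not be [q ^+ 2 > 0]. *)
  rewrite ltNge; apply/negP => mp.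
  have mr : 0 < mu - r by lra.
  by have := mulr_le0_ge0 mp (ltW mr); rewrite qq; lra.
exists q, (mu - p); split => //; first by ring.
by rewrite qE; move: qq; lra.
Qed.

Definition alternating_word (i : nat) : nat := if odd i then (m - m./2)%N else m./2.

Lemma alternating_digits : digit_sequence m alternating_word.
Proof. by move=> i; rewrite /alternating_word; case: ifP => _; lia. Qed.

Lemma prodA_alternating k : prodA alternating_word k.*2 =
  (matA R m m./2 * matA R m (m - m./2)) ^+ k.
Proof.
elim: k => [|k IH]; first by rewrite prodA0.
rewrite doubleS !prodAS IH exprSr -mulrA /alternating_word /= odd_double.
by [].
Qed.

(** Right multiplication by a nonnegative matrix preserves entrywise domination, so the row stays
    above [kap * mu ^+ k] times the eigenvector (e1, e2). *)
Lemma row_alternating : exists2 C : R, 0 < C & forall k,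
  C * mu ^+ k.*2 <=
    row0 (prodA alternating_word k.*2) * row1 (prodA alternating_word k.*2).
Proof.
have [_ [e1 [e2 [e10 e20 E1 E2]]]] := extremal_eigenvector.
have mu0 : 0 <= mu by rewrite sqr_ge0.
(* This makes [kap * e1] and [kap * e2] at most 1, hence dominated by the initial row (lambda,
   1). *)
pose kap := (e1 + e2)^-1.
have s0 : 0 < e1 + e2 by rewrite addr_gt0.
have kap0 : 0 < kap by rewrite invr_gt0.
have h k : kap * e1 * mu ^+ k <= row0 (prodA alternating_word k.*2) /\
           kap * e2 * mu ^+ k <= row1 (prodA alternating_word k.*2).
  elim: k => [|k [IH0 IH1]].
    rewrite prodA0 row0_1 row1_1 expr0 !mulr1 /kap ![_^-1 * _]mulrC.
    rewrite ler_pdivrMr// ler_pdivrMr// mul1r; split; last by lra.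
    by apply: le_trans (ler_wpM2r (ltW s0) lam1); lra.
  rewrite prodA_alternating [(matA _ _ _ * _) ^+ _]exprSr.
  rewrite -prodA_alternating row0M row1M.
  rewrite [mu ^+ k.+1]exprSr.
  have hM := nneg_unimodularM (@matA_nneg m./2 _) (@matA_nneg (m - m./2) _).
  have [||a0 b0 c0 d0 _] := hM; [lia|lia|].
  split.
    have -> : kap * e1 * (mu ^+ k * mu) = kap * mu ^+ k * (mu * e1) by ring.
    rewrite -E1.
    have := ler_wpM2r a0 IH0; have := ler_wpM2r c0 IH1; lra.
  have -> : kap * e2 * (mu ^+ k * mu) = kap * mu ^+ k * (mu * e2) by ring.
  rewrite -E2.
  have := ler_wpM2r b0 IH0; have := ler_wpM2r d0 IH1; lra.
exists (kap * e1 * (kap * e2)); first by rewrite !mulr_gt0.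
move=> k; have [h0 h1] := h k.
have g e : 0 < e -> 0 <= kap * e * mu ^+ k.
  by move=> e0; apply: mulr_ge0; [apply: mulr_ge0; apply: ltW|apply: exprn_ge0].
have -> : mu ^+ k.*2 = mu ^+ k * mu ^+ k by rewrite -addnn exprD.
by rewrite mulrACA; apply: ler_pM; rewrite ?g.
Qed.

Lemma ordered_ifs_mapB : ordered_ifs m (mapB R m) lam^-1.
Proof.
have cE j : mapB R m j = moebius (conjL (matA R m j)) by [].
have l0 : 0 <= lam^-1 by rewrite invr_ge0 ltW.
split => //.
- by move=> j /matA_nneg hj; rewrite cE; apply: moebius_conjL_homo.
- by move=> j y /matA_nneg hj; rewrite cE; apply: moebius_conjL_onto.
- by rewrite cE moebius_conjL0 matAE// mx2E cheb0 mul0r.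
- rewrite cE moebius_conjLT; have -> : m.-1 = m.-2.+1 by lia.
  rewrite matAE// /row0 !mx2E.
  (* For [j = m - 1] the first column of [matA j] is (1, 0), by the symmetry of [cheb]. *)
  have -> : cheb R m m.-2.+2 = 0.
    have -> : m.-2.+2 = m by lia.
    by rewrite -(@cheb_sym R m m_ge3 m)// subnn cheb0.
  have -> : cheb R m m.-2.+1 = 1.
    have -> : m.-2.+1 = (m - 1)%N by lia.
    by rewrite cheb_sym ?cheb1//; lia.
  by rewrite mulr1 addr0 mul1r.
(* The first column of each generator is the second column of the next one. *)
- move=> [//|j] _ jm; rewrite !cE moebius_conjLT moebius_conjL0 !matAE//.
  by rewrite /row0 /row1 !mx2E.
(* Both row entries v, u are at least 1, so [v * u >= v + u - 1 >= n + 1 > e^-1]. *)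
- move=> w dw e e0; exists (Num.truncn e^-1); rewrite cylinderB_length//.
  have [v1 u1 vu] := row_growth (Num.truncn e^-1) dw.
  rewrite invf_plt ?posrE ?mulr_gt0//; [|lra|lra].
  have := truncnS_gt e^-1; rewrite -natr1 => h.
  apply: lt_le_trans h _; nra.
Qed.

End Cylinders.

(** * The Minkowski function *)

Lemma expr_unbounded (R : realType) (t M : R) : 1 < t -> exists n, M < t ^+ n.
Proof.
move=> t1; have bern n : n%:R * (t - 1) <= t ^+ n.
  elim: n => [|n IH]; first by rewrite mul0r expr0.
  have h1 : 1 <= t ^+ n by rewrite exprn_ege1// ltW.
  by rewrite exprS -natr1; nra.
exists (Num.truncn (M / (t - 1))).+1; apply: lt_le_trans (bern _).
by rewrite -ltr_pdivrMr ?subr_gt0// truncnS_gt.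
Qed.

Section Minkowski.
Variables (R : realType) (m : nat).
Hypothesis m_ge3 : (3 <= m)%N.
Local Notation lam := (lambda R m).
Local Notation mu := (rho R m ^+ 2).
Local Notation q := (m%:R - 1 : R).

Let q_ge2 : 2 <= q. Proof. by have : (3%:R : R) <= m%:R; [rewrite ler_nat|lra]. Qed.
Let q_gt0 : 0 < q := lt_le_trans (ltr0n R 2) q_ge2.

Lemma prefix_mapC_sub w n x y :
  prefix_map (mapC R m) w n y - prefix_map (mapC R m) w n x = (y - x) / q ^+ n.
Proof.
elim: n x y => [|n IH] x y; first by rewrite prefix_map0 expr0 divr1.
rewrite !prefix_mapS /= IH /mapC -mulrBl exprS invfM mulrA.
by congr (_ / _ / _); ring.
Qed.

Lemma mapC_first : mapC R m 1 = fun x => x / q.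
Proof. by apply/funext => x; rewrite /mapC addrK. Qed.

Lemma mapC_last x : mapC R m m.-1 x = 1 - (1 - x) / q.
Proof.
rewrite /mapC -subn1 natrB; last by lia.
by field; rewrite gt_eqF.
Qed.

Lemma ordered_ifs_mapC : ordered_ifs m (mapC R m) 1.
Proof.
split => //.
- by move=> j _ x y _ _ xy; rewrite ler_pM2r ?invr_gt0// lerB// lerD2r.
- move=> j y _; rewrite /mapC ler_pdivrMr// ler_pdivlMr// => /andP[h1 h2].
  exists (y * q - j%:R + 1); last by field; rewrite gt_eqF.
  by rewrite in_itv /=; apply/andP; split; lra.
- by rewrite mapC_first mul0r.
- by rewrite mapC_last subrr mul0r subr0.
- by move=> j _ _; rewrite /mapC -natr1; congr (_ / _); ring.
- move=> w _ e e0.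
  have [n hn] := @expr_unbounded R q e^-1 (lt_le_trans (ltr1n R 2) q_ge2).
  exists n; rewrite prefix_mapC_sub subr0 mul1r.
  by rewrite invf_plt ?posrE ?exprn_gt0.
Qed.

Let ifsB := ordered_ifs_mapB R m_ge3.
Let ifsC := ordered_ifs_mapC.

Let minkowskiE : minkowski_fun R m = recoding m (mapB R m) (mapC R m) lam^-1 1.
Proof. by []. Qed.

Let mu1 : 1 < mu := rho2_gt1 R m_ge3.
Let mu0 : 0 < mu := lt_trans ltr01 mu1.

Lemma alpha_gt0 : 0 < alpha R m.
Proof.
have [r1 _] := rho_spec R m_ge3.
by rewrite divr_gt0 ?mulr_gt0 ?ln_gt0//; apply: lt_le_trans q_ge2; rewrite ltr1n.
Qed.

(** The defining relation of alpha, 2 alpha log rho = log(m - 1), in exponential form. *)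
Lemma mu_powR_alpha n : (mu ^+ n) `^ alpha R m = q ^+ n.
Proof.
have [r1 _] := rho_spec R m_ge3.
have r0 : 0 < rho R m by apply: lt_trans r1.
have lr : 0 < ln (rho R m) by apply: ln_gt0.
rewrite -[mu ^+ n]powR_mulrn ?(ltW mu0)// powRAC powR_mulrn ?powR_ge0//.
congr (_ ^+ n).
rewrite /powR gt_eqF// lnXn// /alpha -[ln _ *+ 2]mulr_natl divfK; first by rewrite lnK.
by rewrite mulf_neq0// gt_eqF.
Qed.

Lemma minkowski_itv x : x \in `[0, lam^-1] -> minkowski_fun R m x \in `[0, 1].
Proof. by rewrite minkowskiE; apply: recoding_itv. Qed.

(** A C-cylinder of length comparable to the gap D fits strictly between the two values; the
    B-cylinder of the same word then fits between [x] and [x'], and its length is bounded below. *)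
Lemma minkowski_holder_lt x x' : x \in `[0, lam^-1] -> x' \in `[0, lam^-1] ->
  minkowski_fun R m x < minkowski_fun R m x' ->
  minkowski_fun R m x' - minkowski_fun R m x <=
    2 * q * (lam ^+ 2 + 1) `^ alpha R m * `|x' - x| `^ alpha R m.
Proof.
move=> xI xI' lt_g; set D := _ - _.
have D0 : 0 < D by rewrite subr_gt0.
have := minkowski_itv xI; have := minkowski_itv xI'; rewrite !in_itv /=.
move=> /andP[gx'0 gx'1] /andP[gx0 gx1].
have : exists n, (q ^+ n)^-1 < D / 2.
  have [n hn] := @expr_unbounded R q (D / 2)^-1 (lt_le_trans (ltr1n R 2) q_ge2).
  by exists n; rewrite invf_plt ?posrE ?exprn_gt0// divr_gt0.
(* The least rank with cylinders shorter than D/2; it is positive because D is at most 1. *)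
move=> /[dup] /ex_minnP [[|n] hn nmin] _.
  by move: hn; rewrite expr0 invr1 /D; lra.
have hn' : D <= 2 * q * (q ^+ n.+1)^-1.
  have -> : 2 * q * (q ^+ n.+1)^-1 = 2 * (q ^+ n)^-1.
    by rewrite exprS; field; rewrite expf_neq0 gt_eqF.
  rewrite -ler_pdivrMl// mulrC leNgt; apply/negP => /nmin.
  by rewrite ltnn.
(* The cylinder around the midpoint is shorter than D/2, the distance from [z] to either value. *)
pose z := (minkowski_fun R m x + minkowski_fun R m x') / 2.
have [|w dw wz] := @coding_onto _ _ _ _ ifsC z.
  by rewrite in_itv /= /z; apply/andP; split; lra.
have := coding_mem ifsC n.+1 dw; rewrite wz => /andP[lz zr].
have len := prefix_mapC_sub w n.+1 0 1; rewrite subr0 mul1r in len.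
have h1 : minkowski_fun R m x < prefix_map (mapC R m) w n.+1 0.
  by move: hn lz zr len; rewrite /z /D; lra.
have h2 : prefix_map (mapC R m) w n.+1 1 < minkowski_fun R m x'.
  by move: hn lz zr len; rewrite /z /D; lra.
have := recoding_between ifsB ifsC dw xI xI' h1 h2.
rewrite (cylinderB_length R m_ge3 _ dw).
have [v1 u1 _] := row_growth R m_ge3 n.+1 dw.
have := row_sqnorm_le R m_ge3 n.+1 dw.
set v := row0 _ _ in v1 *; set u := row1 _ _ in u1 *.
set K := lam ^+ 2 + 1 => uvK uvx.
have K0 : 0 < K by rewrite ltr_wpDl// sqr_ge0.
have M0 : 0 < mu ^+ n.+1 by rewrite exprn_gt0.
have uv0 : 0 < v * u by rewrite mulr_gt0//; lra.
have uvK' : v * u <= K * mu ^+ n.+1 by apply: le_trans uvK; nra.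
have xx : (mu ^+ n.+1)^-1 <= K * `|x' - x|.
  rewrite ger0_norm; last by apply: le_trans uvx; rewrite invr_ge0 ltW.
  rewrite -ler_pdivrMl// -invfM; apply: le_trans uvx.
  by rewrite lef_pV2 ?posrE// mulr_gt0.
apply: le_trans hn' _; rewrite -[X in _ <= X]mulrA ler_pM2l ?mulr_gt0//.
rewrite -mu_powR_alpha -powRM ?(ltW K0)//.
rewrite -powR_inv1 ?powR_ge0// powRAC powR_inv1 ?(ltW M0)//.
apply: ge0_ler_powR => //.
- exact: ltW alpha_gt0.
- by rewrite nnegrE invr_ge0 ltW.
- by rewrite nnegrE; apply: mulr_ge0 (ltW K0) _.
Qed.

Lemma minkowski_holder :
  holder_on `[0, lam^-1] (minkowski_fun R m) (alpha R m).
Proof.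
exists (2 * q * (lam ^+ 2 + 1) `^ alpha R m) => x x' xI xI'.
have [h|h|->] := ltgtP (minkowski_fun R m x) (minkowski_fun R m x').
- by rewrite gtr0_norm ?subr_gt0//; apply: minkowski_holder_lt.
- by rewrite distrC gtr0_norm ?subr_gt0// distrC; apply: minkowski_holder_lt.
- by rewrite subrr normr0 !mulr_ge0// ?powR_ge0// ltW.
Qed.

(** * Oscillation on B-cylinders and failure of larger exponents *)

Definition extend_word (w : nat -> nat) (n j i : nat) :=
  if (i < n)%N then w i else j.

Lemma extend_word_digits w n j : digit_sequence m w -> (0 < j < m)%N ->
  digit_sequence m (extend_word w n j).
Proof. by move=> dw hj i; rewrite /extend_word; case: ifP. Qed.

Lemma prefix_extend_word (F : nat -> R -> R) w n j x :
  prefix_map F (extend_word w n j) n.+2 x = prefix_map F w n (F j (F j x)).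
Proof.
rewrite !prefix_mapS /= /extend_word ltnn ltnNge leqnSn /=.
by rewrite (@eq_prefix_map _ F _ w) // => i ->.
Qed.

(** Take midpoints of the subcylinders obtained by appending 1, 1 and m-1, m-1. Relative to the
    C-cylinder their values differ by at least 1 - 2/q^2, hence at least 1/2; a single appended
    letter would give only 1 - 2/q, which is 0 for m = 3. *)
Lemma minkowski_oscillation w n : digit_sequence m w -> exists x x',
  [/\ x \in `[0, lam^-1], x' \in `[0, lam^-1],
     `|x' - x| <= prefix_map (mapB R m) w n lam^-1 - prefix_map (mapB R m) w n 0 &
     (q ^+ n)^-1 / 2 <= minkowski_fun R m x' - minkowski_fun R m x].
Proof.
move=> dw.
have mid j : (0 < j < m)%N -> exists x, [/\ x \in `[0, lam^-1],
    prefix_map (mapB R m) w n 0 <= x <= prefix_map (mapB R m) w n lam^-1 &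
    prefix_map (mapC R m) w n (mapC R m j (mapC R m j 0)) <= minkowski_fun R m x
      <= prefix_map (mapC R m) w n (mapC R m j (mapC R m j 1))].
  move=> hj; have dw' := extend_word_digits n dw hj.
  set w' := extend_word w n j in dw'.
  pose l := prefix_map (mapB R m) w' n.+2 0.
  pose r := prefix_map (mapB R m) w' n.+2 lam^-1.
  have lr : l < r.
    rewrite -subr_gt0 /l /r (cylinderB_length R m_ge3 _ dw') invr_gt0.
    have [v1 u1 _] := row_growth R m_ge3 n.+2 dw'.
    by rewrite mulr_gt0//; lra.
  have ww' : prefix_map (mapB R m) w' n = prefix_map (mapB R m) w n.
    by apply: eq_prefix_map => i hi; rewrite /w' /extend_word hi.
  have hl : prefix_map (mapB R m) w n 0 <= l.
    by rewrite -ww'; apply: prefix_map0_nd ifsB _ _ _ dw' _; lia.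
  have hr : r <= prefix_map (mapB R m) w n lam^-1.
    by rewrite -ww'; apply: prefix_mapT_ni ifsB _ _ _ dw' _; lia.
  have l0 := prefix_map0_nd ifsB dw (leq0n n).
  have r0 := prefix_mapT_ni ifsB dw (leq0n n).
  rewrite !prefix_map0 /= in l0 r0.
  have xI : (l + r) / 2 \in `[0, lam^-1].
    by rewrite in_itv /=; apply/andP; split; lra.
  exists ((l + r) / 2); split => //; first by apply/andP; split; lra.
  rewrite -!prefix_extend_word; apply: (recoding_interior ifsB ifsC dw' xI).
  by rewrite -/l -/r; apply/andP; split; lra.
have [x [xI /andP[lx xr] /andP[_ gx]]] := mid 1%N (ltac:(lia)).
have [x' [xI' /andP[lx' xr'] /andP[gx' _]]] := mid m.-1 (ltac:(lia)).
exists x, x'; split => //; first by rewrite ler_norml; apply/andP; split; lra.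
apply: le_trans (lerB gx' gx).
rewrite prefix_mapC_sub [X in X <= _]mulrC ler_pM2r ?invr_gt0 ?exprn_gt0//.
rewrite !mapC_last mapC_first subr0 mul1r.
have q4 : q^-1 <= 2^-1 by rewrite lef_pV2 ?posrE.
have q0 : 0 < q^-1 by rewrite invr_gt0.
by nra.
Qed.

(** Along alternating words of length 2k the function varies by at least [q^(-2k) / 2] over a
    distance at most [C^-1 mu^(-2k)]; exponent beta would bound the powers of
    [mu^(beta - alpha) > 1]. *)
Lemma minkowski_not_holder beta : alpha R m < beta ->
  ~ holder_on `[0, lam^-1] (minkowski_fun R m) beta.
Proof.
move=> ab [c hc]; have b0 : 0 < beta := lt_trans alpha_gt0 ab.
have [C C0 hC] := row_alternating R m_ge3.
have dw := alternating_digits R m_ge3; set w := alternating_word m in hC dw.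
(* The bound on [t ^+ k.*2] that the Hölder inequality will force, contradicting the choice of
   [k]. *)
pose M := 2 * `|c| * C^-1 `^ beta.
have t1 : 1 < mu `^ (beta - alpha R m).
  rewrite -(powRr0 mu) /powR gt_eqF// ltr_expR ltr_pM2r ?ln_gt0//.
  by rewrite subr_gt0.
have [k hk] := expr_unbounded M t1.
set t := mu `^ _ in t1 hk.
have [x [x' [xI xI' xx' gg']]] := minkowski_oscillation k.*2 dw.
have m0 : 0 < mu ^+ k.*2 by rewrite exprn_gt0.
have m0' : 0 < (mu ^+ k.*2) `^ beta by rewrite powR_gt0.
have {}xx' : `|x' - x| <= C^-1 / mu ^+ k.*2.
  apply: le_trans xx' _; rewrite cylinderB_length// -invfM.
  have Cm0 : 0 < C * mu ^+ k.*2 by rewrite mulr_gt0.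
  by rewrite lef_pV2 ?posrE// (lt_le_trans Cm0).
have h1 : (q ^+ k.*2)^-1 / 2 <= `|c| * (C^-1 `^ beta / (mu ^+ k.*2) `^ beta).
  apply: le_trans gg' _; apply: le_trans (ler_norm _) _.
  apply: le_trans (hc _ _ xI xI') _.
  apply: le_trans (ler_wpM2r (powR_ge0 _ _) (ler_norm c)) _.
  apply: ler_wpM2l => //.
  have -> : ((mu ^+ k.*2) `^ beta)^-1 = ((mu ^+ k.*2)^-1) `^ beta.
    by rewrite -[in RHS]powR_inv1 ?(ltW m0)// powRAC powR_inv1 ?powR_ge0.
  rewrite -powRM ?invr_ge0 ?(ltW m0) ?(ltW C0)//.
  by apply: ge0_ler_powR; rewrite ?nnegrE ?(ltW b0)// mulr_ge0 ?invr_ge0 ?(ltW C0) ?(ltW m0).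
have tE : (mu ^+ k.*2) `^ beta = t ^+ k.*2 * q ^+ k.*2.
  have -> : t ^+ k.*2 = (mu ^+ k.*2) `^ (beta - alpha R m).
    by rewrite -powR_mulrn ?powR_ge0// /t powRAC powR_mulrn ?(ltW mu0).
  by rewrite -mu_powR_alpha -powRD ?subrK// (gt_eqF m0) implybT.
have q0 : 0 < q ^+ k.*2 by rewrite exprn_gt0.
have t0 : 0 < t ^+ k.*2 by rewrite exprn_gt0// (lt_trans _ t1).
have h2 : t ^+ k.*2 <= M.
  have := ler_wpM2r (ltW m0') h1; rewrite !mulrA mulfVK ?gt_eqF// tE.
  rewrite [X in X <= _](_ : _ = t ^+ k.*2 / 2); last by field; rewrite gt_eqF.
  by rewrite ler_pdivrMr// /M; lra.
have h3 : t ^+ k <= t ^+ k.*2.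
  by apply: ler_weXn2l; [exact: ltW|rewrite -addnn leq_addr].
by have := le_lt_trans (le_trans h3 h2) hk; rewrite ltxx.
Qed.

End Minkowski.

(** * The joint spectral radius *)

Section VectorNorm.
Variables (R : realType) (N : 'cV[R]_2 -> R).
Hypothesis normN : is_vector_norm N.
Implicit Types x y : 'cV[R]_2.

Let normD x y : N (x + y) <= N x + N y. Proof. by have [h _ _] := normN. Qed.
Let normZ (a : R) x : N (a *: x) = `|a| * N x. Proof. by have [_ h _] := normN. Qed.

Lemma vector_norm0 : N 0 = 0.
Proof. by rewrite -(scale0r 0) normZ normr0 mul0r. Qed.

Lemma vector_normN x : N (- x) = N x.
Proof. by rewrite -scaleN1r normZ normrN normr1 mul1r. Qed.

Lemma vector_norm_ge0 x : 0 <= N x.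
Proof. by have := normD x (- x); rewrite subrr vector_norm0 vector_normN; lra. Qed.

Lemma vector_norm_gt0 x : x != 0 -> 0 < N x.
Proof.
move=> x0; rewrite lt0r vector_norm_ge0 andbT.
by apply: contra_neq x0; have [_ _ h] := normN; apply: h.
Qed.

(** N is Lipschitz along the line, so it attains on the segment a minimum, which is positive because
    the line avoids 0. *)
Lemma vector_norm_affine_min x y : (forall t, x + t *: y != 0) ->
  exists2 c, 0 < c & forall t, -1 <= t <= 1 -> c <= N (x + t *: y).
Proof.
move=> xy0; pose f t := N (x + t *: y).
have lip s t : f s <= f t + `|t - s| * N y.
  have -> : f s = N ((x + t *: y) + (s - t) *: y).
    by rewrite /f -addrA -scalerDl [t + _]addrC subrK.
  by rewrite distrC -normZ.
have cf : continuous f.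
  move=> t; apply/cvgrPdist_le => e e0.
  have K0 : 0 < N y + 1 by have := vector_norm_ge0 y; lra.
  near=> s.
  have ts : `|t - s| <= e / (N y + 1).
    near: s; apply: (@cvgr_dist_le _ _ _ _ _ id t); [exact: cvg_id|exact: divr_gt0].
  have h : `|t - s| * N y <= e.
    apply: le_trans (ler_wpM2r (vector_norm_ge0 y) ts) _.
    by rewrite mulrAC ler_pdivrMr// ler_pM2l//; lra.
  have := lip s t; have := lip t s; rewrite distrC => h1 h2.
  by rewrite ler_norml; apply/andP; split; lra.
have [||c cI cmin] := @EVT_min R f (-1) 1.
- lra.
- exact: continuous_subspaceT.
exists (f c); first exact: vector_norm_gt0.
by move=> t ht; apply: cmin; rewrite in_itv.
Unshelve. all: by end_near.
Qed.


Definition euclid x : R := Num.sqrt (x 0 0 ^+ 2 + x 1 0 ^+ 2).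

Definition col2 (a b : R) : 'cV[R]_2 := \col_i (if i == 0 then a else b).

Lemma col2_0 a b : col2 a b 0 0 = a. Proof. by rewrite mxE. Qed.
Lemma col2_1 a b : col2 a b 1 0 = b. Proof. by rewrite mxE. Qed.

Lemma col2P x y : x 0 0 = y 0 0 -> x 1 0 = y 1 0 -> x = y.
Proof.
move=> h0 h1; apply/matrixP => -[[|[|i]] hi] j //; rewrite (ord1 j).
- by have -> : Ordinal hi = 0 by apply: val_inj.
- by have -> : Ordinal hi = 1 by apply: val_inj.
Qed.

Let absE_le x : `|x 0 0| <= euclid x /\ `|x 1 0| <= euclid x.
Proof.
rewrite -!sqrtr_sqr /euclid; split;
  by rewrite ler_sqrt ?addr_ge0 ?sqr_ge0// ?lerDl ?lerDr sqr_ge0.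
Qed.

Let euclid_le x : euclid x <= `|x 0 0| + `|x 1 0|.
Proof.
rewrite -[X in _ <= X]ger0_norm ?addr_ge0// -sqrtr_sqr ler_sqrt ?sqr_ge0//.
rewrite -(real_normK (num_real (x 0 0))) -(real_normK (num_real (x 1 0))).
by have := normr_ge0 (x 0 0); have := normr_ge0 (x 1 0); nra.
Qed.

Lemma vector_norm_le_euclid : exists2 C, 0 < C & forall x, N x <= C * euclid x.
Proof.
have e0 := vector_norm_ge0 (col2 1 0); have e1 := vector_norm_ge0 (col2 0 1).
exists (N (col2 1 0) + N (col2 0 1) + 1); first by lra.
move=> x; have [h0 h1] := absE_le x.
have -> : x = x 0 0 *: col2 1 0 + x 1 0 *: col2 0 1.
  by apply: col2P; rewrite !mxE /=; ring.
apply: le_trans (normD _ _) _; rewrite !normZ.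
(* The expansion also replaced [x] inside [euclid]; this restores it there. *)
have -> : x 0 0 *: col2 1 0 + x 1 0 *: col2 0 1 = x.
  by apply: col2P; rewrite !mxE /=; ring.
by have := normr_ge0 (x 0 0); nra.
Qed.

(** Dividing a nonzero vector by its larger coordinate puts it on a segment (1, t) or (t, 1) with
    [|t| <= 1], where N is bounded below. *)
Lemma euclid_le_vector_norm : exists2 C, 0 < C & forall x, euclid x <= C * N x.
Proof.
have [t|c c0 hc] := @vector_norm_affine_min (col2 1 0) (col2 0 1).
  apply/negP => /eqP /(congr1 (fun v : 'cV[R]_2 => v 0 0)).
  by rewrite !mxE /= mulr0 addr0 => /eqP; rewrite oner_eq0.
have [t|d d0 hd] := @vector_norm_affine_min (col2 0 1) (col2 1 0).
  apply/negP => /eqP /(congr1 (fun v : 'cV[R]_2 => v 1 0)).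
  by rewrite !mxE /= mulr0 addr0 => /eqP; rewrite oner_eq0.
have key (a b C : R) (v : R -> R) : 0 < C -> `|b| <= `|a| ->
    (forall t, -1 <= t <= 1 -> C <= v t) ->
    a != 0 -> `|a| + `|b| <= 2 * C^-1 * (`|a| * v (b / a)).
  move=> C0 ba hv a0; have na : 0 < `|a| by rewrite normr_gt0.
  have h : C <= v (b / a).
    apply: hv; have : `|b / a| <= 1; last by rewrite ler_norml.
    by rewrite normrM normfV ler_pdivrMr// mul1r.
  apply: (@le_trans _ _ (2 * `|a|)); first by lra.
  by rewrite -mulrA ler_pM2l// mulrCA ler_peMr ?normr_ge0// ler_pdivlMl// mulr1.
exists (2 * c^-1 + 2 * d^-1); first by rewrite addr_gt0 ?mulr_gt0 ?invr_gt0.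
move=> x; apply: le_trans (euclid_le x) _.
have N0 := vector_norm_ge0 x.
have c0' : 0 <= 2 * c^-1 by rewrite mulr_ge0 ?invr_ge0 ?ltW.
have d0' : 0 <= 2 * d^-1 by rewrite mulr_ge0 ?invr_ge0 ?ltW.
have [h|h] := leP `|x 1 0| `|x 0 0|.
  have [x0|x0] := eqVneq (x 0 0) 0.
    move: h; rewrite x0 normr0 normr_le0 => /eqP ->.
    by rewrite normr0 addr0 mulr_ge0 ?addr_ge0.
  have := key _ _ _ (fun t => N (col2 1 0 + t *: col2 0 1)) c0 h hc x0.
  rewrite /= -normZ (_ : _ *: _ = x); last first.
    by apply: col2P; rewrite !mxE /=; field.
  by rewrite mulrDl; have := mulr_ge0 d0' N0; lra.
have x1 : x 1 0 != 0 by rewrite -normr_gt0; apply: le_lt_trans h.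
have := key _ _ _ (fun t => N (col2 0 1 + t *: col2 1 0)) d0 (ltW h) hd x1.
rewrite /= -normZ (_ : _ *: _ = x); last first.
  by apply: col2P; rewrite !mxE /=; field.
by rewrite mulrDl; have := mulr_ge0 c0' N0; lra.
Qed.

Lemma operator_norm_euclid_bound : exists2 C, 0 < C & forall (M : 'M[R]_2) k,
  0 <= k -> (forall x, euclid (M *m x) <= k * euclid x) ->
  forall x, N x <= 1 -> N (M *m x) <= C * k.
Proof.
have [C C0 hC] := vector_norm_le_euclid; have [D D0 hD] := euclid_le_vector_norm.
exists (C * D); first exact: mulr_gt0.
move=> M k k0 hM x x1; apply: le_trans (hC _) _.
rewrite -mulrA ler_pM2l//; apply: le_trans (hM x) _.
rewrite mulrC ler_wpM2r//; apply: le_trans (hD x) _.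
by rewrite -[X in _ <= X]mulr1 ler_pM2l.
Qed.

End VectorNorm.

Lemma limn_esup_le (R : realType) (u : nat -> \bar R) (l : \bar R) n0 :
  (forall n, (n0 <= n)%N -> u n <= l)%E -> (limn_esup u <= l)%E.
Proof.
move=> h; apply: ge_ereal_inf; exists (ereal_sup (u @` [set n | (n0 <= n)%N])).
  by exists [set n | (n0 <= n)%N] => //; exists n0.
by apply: ge_ereal_sup => _ [n /= hn <-]; apply: h.
Qed.

Lemma le_limn_esup (R : realType) (u : nat -> \bar R) (l : \bar R) :
  (forall n0, exists2 n, (n0 <= n)%N & l <= u n)%E -> (l <= limn_esup u)%E.
Proof.
move=> h; apply: le_ereal_inf_tmp => _ [V [n0 _ hV] <-].
have [n hn ln] := h n0; apply: le_ereal_sup_tmp; exists (u n) => //.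
by exists n => //; apply: hV.
Qed.

(** * Bounds for the joint spectral radius *)

Section JointSpectralRadius.
Variables (R : realType) (m : nat).
Hypothesis m_ge3 : (3 <= m)%N.
Variable N : 'cV[R]_2 -> R.
Hypothesis normN : is_vector_norm N.
Local Notation rho := (rho R m).

Let rho1 : 1 < rho := proj1 (rho_spec R m_ge3).
Let rho0 : 0 < rho := lt_trans ltr01 rho1.

Lemma euclid_matA j x : (0 < j < m)%N -> euclid (matA R m j *m x) <= rho * euclid x.
Proof.
move=> hj; rewrite /euclid !(mulmx2E (matA R m j) x).
have -> : rho * Num.sqrt (x 0 0 ^+ 2 + x 1 0 ^+ 2) =
    Num.sqrt (rho ^+ 2 * (x 0 0 ^+ 2 + x 1 0 ^+ 2)).
  by rewrite sqrtrM ?sqr_ge0// sqrtr_sqr gtr0_norm.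
rewrite ler_sqrt; last by rewrite mulr_ge0 ?addr_ge0 ?sqr_ge0.
exact: (matA_sqnorm_le m_ge3 (x 0 0) (x 1 0) hj).
Qed.

Lemma euclid_products n M x : products (familyA R m) n M ->
  euclid (M *m x) <= rho ^+ n * euclid x.
Proof.
move=> [w [wn hw] <-] {M}; elim: w n wn hw x => [|X w IH] n /= <- hw x.
  by rewrite big_nil expr0 mul1r mul1mx.
rewrite big_cons -mulmxA exprS -mulrA.
have [j hj <-] := hw X (mem_head _ _).
apply: le_trans (euclid_matA _ hj) _; rewrite ler_pM2l//.
by apply: IH => // Y Yw; apply: hw; rewrite in_cons Yw orbT.
Qed.

(** The Euclidean estimate bounds the set whose [sup] is the operator norm, so that this [sup] is an
    upper bound; C is uniform in the length. *)
Lemma operator_norm_products : exists2 C, 0 < C & forall n M,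
  products (familyA R m) n M ->
  (forall x, N x <= 1 -> N (M *m x) <= operator_norm N M) /\
  operator_norm N M <= C * rho ^+ n.
Proof.
have [C C0 hC] := operator_norm_euclid_bound normN.
exists C => // n M hM.
have bnd x : N x <= 1 -> N (M *m x) <= C * rho ^+ n.
  by apply: hC => [|y]; [rewrite exprn_ge0// ltW|apply: euclid_products].
split => [x x1|].
  by apply: ub_le_sup; [exists (C * rho ^+ n) => _ [y /= y1 <-]; apply: bnd|exists x].
apply: ge_sup; last by move=> _ [y /= y1 <-]; apply: bnd.
by exists (N (M *m 0)), 0; rewrite /= ?vector_norm0.
Qed.

Lemma operator_norm_products_ge0 n M : products (familyA R m) n M ->
  0 <= operator_norm N M.
Proof.
have [C C0 hC] := operator_norm_products => hM; have [h _] := hC _ _ hM.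
by apply: le_trans (h 0 _); rewrite ?mulmx0 vector_norm0.
Qed.

Let root_expr (a : R) n : 0 <= a -> (0 < n)%N -> (a ^+ n) `^ n%:R^-1 = a.
Proof.
by move=> a0 n0; rewrite -powR_mulrn// -powRrM divff ?powRr1// pnatr_eq0 -lt0n.
Qed.

Lemma joint_spectral_radius_le :
  (joint_spectral_radius N (familyA R m) <= rho%:E)%E.
Proof.
have [C C0 hC] := operator_norm_products.
apply/lee_addgt0Pr => e e0.
have d1 : 1 < 1 + e / rho by rewrite ltrDl divr_gt0.
have [n0 hn0] := expr_unbounded C d1.
(* From [n0] on, [C * rho ^+ n <= (rho + e) ^+ n]; the maximum with 1 excludes the zeroth root. *)
apply: (@limn_esup_le _ _ _ (maxn n0 1)) => n; rewrite geq_max => /andP[n0n n1].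
apply: ge_ereal_sup => _ [M hM <-]; rewrite lee_fin.
have [_ h] := hC _ _ hM.
have -> : rho + e = ((rho + e) ^+ n) `^ n%:R^-1.
  by rewrite root_expr// addr_ge0 ?ltW.
apply: ge0_ler_powR; rewrite ?nnegrE ?invr_ge0 ?exprn_ge0 ?addr_ge0
  ?(ltW rho0) ?(ltW e0)//.
  exact: operator_norm_products_ge0 hM.
apply: le_trans h _.
have -> : rho + e = (1 + e / rho) * rho by field; rewrite gt_eqF.
rewrite exprMn ler_pM2r ?exprn_gt0//; apply: le_trans (ltW hn0) _.
by apply: ler_weXn2l => //; apply: ltW.
Qed.

Lemma prodA_products w n : digit_sequence m w ->
  products (familyA R m) n (prodA R m w n).
Proof.
move=> dw; exists (mkseq (fun i => matA R m (w i)) n).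
  split; first by rewrite size_mkseq.
  by move=> X /mapP[i _ ->]; exists (w i) => //; apply: dw.
by rewrite /prodA big_map /index_iota subn0.
Qed.

Lemma joint_spectral_radius_ge :
  (rho%:E <= joint_spectral_radius N (familyA R m))%E.
Proof.
have [C C0 hC] := operator_norm_products.
have [sym [e1 [e2 [e10 e20 E1 E2]]]] := extremal_eigenvector R m_ge3.
set P := matA R m m./2 * _ in sym E1 E2.
(* Symmetry turns the row eigenvector into a column eigenvector. *)
have symE i j : P i j = P j i by rewrite -{1}sym mxE.
pose v := col2 e1 e2.
have Pv : P *m v = rho ^+ 2 *: v.
  apply: col2P; rewrite mulmx2E [RHS]mxE !col2_0 !col2_1.
    by rewrite -E1 (symE 0 1); ring.
  by rewrite -E2 (symE 1 0); ring.
have Pkv k : (P ^+ k) *m v = rho ^+ k.*2 *: v.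
  elim: k => [|k IH]; first by rewrite expr0 scale1r mul1mx.
  rewrite exprSr -mulmxA Pv -scalemxAr IH scalerA -exprD; congr (_ ^+ _ *: _).
have v0 : v != 0.
  apply/negP => /eqP /(congr1 (fun u : 'cV[R]_2 => u 0 0)).
  by rewrite col2_0 mxE => h; move: e10; rewrite h ltxx.
have Nv := vector_norm_gt0 normN v0.
apply: le_limn_esup => n0; exists n0.+1.*2; first by lia.
have dw := alternating_digits R m_ge3.
have hP := prodA_products n0.+1.*2 dw.
apply: le_ereal_sup_tmp.
exists (operator_norm N (prodA R m (alternating_word m) n0.+1.*2)
  `^ (n0.+1.*2%:R)^-1)%:E.
  by exists (prodA R m (alternating_word m) n0.+1.*2).
rewrite lee_fin -[X in X <= _](@root_expr _ n0.+1.*2) ?(ltW rho0)//.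
have [h _] := hC _ _ hP; have [_ normZ _] := normN.
apply: ge0_ler_powR; rewrite ?nnegrE ?invr_ge0 ?exprn_ge0 ?(ltW rho0)//.
  exact: operator_norm_products_ge0 hP.
(* The normalised eigenvector shows that the operator norm is at least rho to the length of the
   word. *)
have := h ((N v)^-1 *: v); rewrite prodA_alternating// -scalemxAr Pkv !normZ.
rewrite normfV (gtr0_norm Nv) mulVf ?gt_eqF// => /(_ (lexx _)).
by rewrite mulrCA mulVf ?gt_eqF// mulr1 ger0_norm// exprn_ge0// ltW.
Qed.

End JointSpectralRadius.

Theorem theorem5p4 (R : realType) (m : nat) (hm : (3 <= m)%N) :
  (forall N : 'cV[R]_2 -> R, is_vector_norm N ->
     joint_spectral_radius N (familyA R m) = (rho R m)%:E) /\
  (holder_on `[0, (lambda R m)^-1] (minkowski_fun R m) (alpha R m) /\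
   forall beta : R, alpha R m < beta ->
     ~ holder_on `[0, (lambda R m)^-1] (minkowski_fun R m) beta).
Proof.
split; last by split; [exact: minkowski_holder|exact: minkowski_not_holder].
move=> N normN; apply/le_anti/andP; split.
  exact: joint_spectral_radius_le.
exact: joint_spectral_radius_ge.
Qed.
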